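(* Let $d\ge1$, let $R_j$, $j=1,\dots,d$, be the Riesz transforms on $\mathbb{R}^d$, and let $b_1,b_2$ be complex valued with $b_1,b_2\in L^3_{loc}(\mathbb{R}^d)$ and $b_1b_2\in L^2_{loc}(\mathbb{R}^d)$. Then $$S_2(b_1,b_2)+T_2(b_1,b_2)\le C_d\sum_{j=1}^d\|C_bR_j\|_{L^2\to L^2},$$ where $C_d$ depends only on $d$.
   Context: $R_jf(x)=\lim_{\varepsilon\to0}\int_{|x-y|>\varepsilon}\frac{x_j-y_j}{|x-y|^{d+1}}f(y)\,dy$. With $b=(b_1,b_2)$ and an operator $T$, the commutator $C_bT=[b_2,[b_1,T]]$ is defined on $L^\infty_c(\mathbb{R}^d)$, where $[A,B]=AB-BA$ and $b_i$ acts by pointwise multiplication; $\|C_bT\|_{L^2\to L^2}$ is the supremum of $\|C_bTf\|_{L^2}$ over $f\in L^\infty_c$ with $\|f\|_{L^2}\le1$ (possibly $+\infty$). For $0<p<\infty$ and $\langle g\rangle_Q=\frac1{|Q|}\int_Q g$, with suprema over all cubes $Q\subset\mathbb{R}^d$: $S_p(b_1,b_2)=\sup_Q\big(\frac1{|Q|}\int_Q|b_1-\langle b_1\rangle_Q|^p\big)^{1/p}\big(\frac1{|Q|}\int_Q|b_2-\langle b_2\rangle_Q|^p\big)^{1/p}$ and $T_p(b_1,b_2)=\sup_Q\big(\frac1{|Q|}\int_Q|b_1-\langle b_1\rangle_Q|^p|b_2-\langle b_2\rangle_Q|^p\big)^{1/p}$. *)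

(* Defs.v *)
From HB Require Import structures.
From mathcomp Require Import all_boot all_order all_algebra.
From mathcomp Require Import all_classical all_reals all_analysis.
From mathcomp Require Import complex.
Set Implicit Arguments. Unset Strict Implicit. Unset Printing Implicit Defensive.
Import Order.TTheory GRing.Theory Num.Theory.
Import numFieldNormedType.Exports.
Local Open Scope classical_set_scope.
Local Open Scope ring_scope.

(* (The library's sigma-finite instance on [\x] is shadowed by the           *)
(*  subprobability instance, so we re-register it on a wrapper.)             *)
Section pmeas.
Context d1 d2 (T1 : measurableType d1) (T2 : measurableType d2) (R : realType).
Variables (m1 : {sigma_finite_measure set T1 -> \bar R})
          (m2 : {sigma_finite_measure set T2 -> \bar R}).

Definition pmeas : set (T1 * T2)%type -> \bar R := (m1 \x m2)%E.

HB.instance Definition _ := Measure.on pmeas.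

Let pmeas_sigma_finite : sigma_finite setT pmeas.
Proof.
have /sigma_finiteP[F [TF ndF Foo]] := sigma_finiteT m1.
have /sigma_finiteP[G [TG ndG Goo]] := sigma_finiteT m2.
exists (fun n => F n `*` G n).
 rewrite -setXTT TF TG predeqE => -[x y]; split.
    move=> [/= [n _ Fnx] [k _ Gky]]; exists (maxn n k) => //; split.
    - by move: x Fnx; exact/subsetPset/ndF/leq_maxl.
    - by move: y Gky; exact/subsetPset/ndG/leq_maxr.
  by move=> [n _ []/= ? ?]; split; exists n.
move=> k; have [? ?] := Foo k; have [? ?] := Goo k.
split; first exact: measurableX.
by rewrite /pmeas product_measure1E// lte_mul_pinfty// ge0_fin_numE.
Qed.

HB.instance Definition _ := Measure_isSigmaFinite.Build _ _ _ pmeas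
  pmeas_sigma_finite.
End pmeas.

Record msp (R : realType) := MSp {
  msp_disp : measure_display;
  msp_car : measurableType msp_disp;
  msp_meas : {sigma_finite_measure set msp_car -> \bar R} }.

Fixpoint Rsp (R : realType) (n : nat) : msp R :=
  match n with
  | 0 => @MSp R _ unit (SigmaFiniteMeasure.clone _ _ _ (@dirac _ unit tt R) _)
  | n'.+1 => @MSp R _ _
      (SigmaFiniteMeasure.clone _ _ _
         (pmeas (@lebesgue_measure R) (msp_meas (Rsp R n'))) _)
  end.

Definition Rd (R : realType) (n : nat) : measurableType (msp_disp (Rsp R n)) :=
  msp_car (Rsp R n).
Definition leb (R : realType) (n : nat) : {measure set Rd R n -> \bar R} :=
  msp_meas (Rsp R n).

(* coordinates: coord x j = x_j (0-based), for j < n; 0 beyond *)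
Fixpoint coord (R : realType) (n : nat) : Rd R n -> nat -> R :=
  match n return Rd R n -> nat -> R with
  | 0 => fun _ _ => 0
  | n'.+1 => fun x j =>
      match j with
      | 0 => (x.1 : R)
      | j'.+1 => coord (x.2 : Rd R n') j'
      end
  end.

Section defs.
Variables (R : realType) (d : nat).
Local Notation Rd := (Rd R d).
Local Notation leb := (leb R d).
Local Open Scope complex_scope.

Definition cabs (z : R[i]) : R :=
  Num.sqrt (complex.Re z ^+ 2 + complex.Im z ^+ 2).

Definition edist (x y : Rd) : R :=
  Num.sqrt (\sum_(k < d) (coord x k - coord y k) ^+ 2).

Definition cube (c : nat -> R) (l : R) : set Rd :=
  [set x | forall k, (k < d)%N -> c k <= coord x k < c k + l].

Definition cubes : set (set Rd) :=
  [set Q | exists c l, 0 < l /\ Q = cube c l].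

Definition cmeasurable (f : Rd -> R[i]) :=
  measurable_fun setT (fun x => complex.Re (f x)) /\ measurable_fun setT (fun x => complex.Im (f x)).

Definition cint (A : set Rd) (f : Rd -> R[i]) : R[i] :=
  Complex (Rintegral leb A (fun x => complex.Re (f x)))
          (Rintegral leb A (fun x => complex.Im (f x))).

Definition Lploc (p : nat) (f : Rd -> R[i]) :=
  cmeasurable f /\
  forall Q, cubes Q -> (\int[leb]_(x in Q) ((cabs (f x)) ^+ p)%:E < +oo)%E.

Definition Linfc (f : Rd -> R[i]) :=
  cmeasurable f /\ (exists M : R, forall x, cabs (f x) <= M) /\
  (exists Q, cubes Q /\ forall x, ~ Q x -> f x = 0).

Definition L2norm (f : Rd -> R[i]) : \bar R :=
  Lnorm leb 2%:E (fun x => (cabs (f x))%:E).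

Definition riesz_trunc (j : nat) (g : Rd -> R[i]) (x : Rd) (eps : R) : R[i] :=
  cint [set y | eps < edist x y]
    (fun y => ((coord x j - coord y j) / (edist x y) ^+ d.+1)%:C * g y).

Definition riesz (j : nat) (g : Rd -> R[i]) (x : Rd) : R[i] :=
  Complex (lim ((fun eps => complex.Re (riesz_trunc j g x eps)) @ 0^'+))
          (lim ((fun eps => complex.Im (riesz_trunc j g x eps)) @ 0^'+)).

Definition mult (b : Rd -> R[i]) (g : Rd -> R[i]) : Rd -> R[i] :=
  fun x => b x * g x.

Definition commut (b : Rd -> R[i]) (T : (Rd -> R[i]) -> (Rd -> R[i])) :=
  fun g => fun x => mult b (T g) x - T (mult b g) x.

Definition CbT (b1 b2 : Rd -> R[i]) (T : (Rd -> R[i]) -> (Rd -> R[i])) :=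
  commut b2 (commut b1 T).

Definition opnorm2 (T : (Rd -> R[i]) -> (Rd -> R[i])) : \bar R :=
  ereal_sup [set L2norm (T f) | f in [set f | Linfc f /\ (L2norm f <= 1)%E]].

Definition cavg (Q : set Rd) (g : Rd -> R[i]) : R[i] :=
  ((fine (leb Q))^-1)%:C * cint Q g.

Definition ravg (Q : set Rd) (h : Rd -> R) : \bar R :=
  ((fine (leb Q))^-1)%:E * (\int[leb]_(x in Q) (h x)%:E).

Definition osc (Q : set Rd) (b : Rd -> R[i]) (x : Rd) : R := cabs (b x - cavg Q b).

Definition Sp (p : R) (b1 b2 : Rd -> R[i]) : \bar R :=
  ereal_sup [set
    ((ravg Q (fun x => (osc Q b1 x `^ p)%R)) `^ (p^-1)%R *
     (ravg Q (fun x => (osc Q b2 x `^ p)%R)) `^ (p^-1)%R)%E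
    | Q in cubes].

Definition Tp (p : R) (b1 b2 : Rd -> R[i]) : \bar R :=
  ereal_sup [set
    ((ravg Q (fun x => (osc Q b1 x `^ p * osc Q b2 x `^ p)%R)) `^ (p^-1)%R)%E
    | Q in cubes].

End defs.

(* Main.v *)
Require Import Defs.
From HB Require Import structures.
From mathcomp Require Import all_boot all_order all_algebra.
From mathcomp Require Import all_classical all_reals all_analysis.
From mathcomp Require Import measurable_realfun complex ring lra.
Import Order.TTheory GRing.Theory Num.Theory.
Import numFieldNormedType.Exports.
Local Open Scope classical_set_scope.
Local Open Scope ring_scope.
Set Implicit Arguments. Unset Strict Implicit. Unset Printing Implicit Defensive.

(* Let k(x,y) = (b1 x - b1 y)(b2 x - b2 y), so that the kernel of C_b R_j is
   k(x,y) K_j(x - y). If f and g are supported in a cube Q of side l, at positive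
   distance from each other, no principal value occurs and
   <C_b R_j f, g> = \iint k K_j f g, which is bounded by the operator norm.

   Multiply this kernel by sum_j (x_j - y_j) K_j(x - y) |x - y|^(d-1) = 1. The factors
   x_j - y_j are sums of functions of x alone and of y alone. The distance |x - y| is
   harmless too: by inverse stereographic projection it is, up to a function of x and
   a function of y, sqrt(1 - tau) with tau = <xi, eta> for unit vectors xi = xi(x),
   eta = xi(y). Multiplication by tau is contractive, and 1 - sqrt(1 - tau) is the limit
   of q_(n+1) = (tau + q_n^2)/2, all of which are contractive. Hence
   |\iint k f g| <= C l^d ||f|| ||g|| sum_j ||C_b R_j|| for separated f and g.

   To drop the separation, cut Q into thin slabs and colour them with fair coins:
   4 E[1_A(x) 1_(A^c)(y)] = 1 whenever x and y lie in different slabs, and the pairs in a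
   common slab disappear in the limit.

   Finally k does not change when the averages of b1, b2 over Q are subtracted; then
   f = 1, g = conj(b1 b2) gives T_2 and f = conj b1, g = conj b2 gives S_2, because
   all remaining terms vanish or have the favourable sign. *)

Local Notation Re := complex.Re.
Local Notation Im := complex.Im.

(** * Complex numbers through real and imaginary parts *)

Section complex_facts.
Context {R : realType}.
Implicit Types (z w : R[i]) (a : R).

(** Preferred to [cabs] because it is polynomial in the real and imaginary parts, which leaves
    identities to [ring]. *)
Definition sqn z : R := Re z ^+ 2 + Im z ^+ 2.

Lemma ReM z w : Re (z * w) = Re z * Re w - Im z * Im w.
Proof. by case: z w => [a b] [c e]. Qed.

Lemma ImM z w : Im (z * w) = Re z * Im w + Im z * Re w.
Proof. by case: z w => [a b] [c e]. Qed.

Lemma ReD z w : Re (z + w) = Re z + Re w.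
Proof. by case: z w => [a b] [c e]. Qed.

Lemma ImD z w : Im (z + w) = Im z + Im w.
Proof. by case: z w => [a b] [c e]. Qed.

Lemma ReN z : Re (- z) = - Re z.
Proof. by case: z. Qed.

Lemma ImN z : Im (- z) = - Im z.
Proof. by case: z. Qed.

Definition ReImE := (ReM, ImM, ReD, ImD, ReN, ImN).

Lemma complex_eq z w : Re z = Re w -> Im z = Im w -> z = w.
Proof. by case: z w => [a b] [c e] /= -> ->. Qed.

Lemma sqn_ge0 z : 0 <= sqn z.
Proof. by rewrite addr_ge0// sqr_ge0. Qed.

Lemma sqnM z w : sqn (z * w) = sqn z * sqn w.
Proof. rewrite /sqn !ReImE; ring. Qed.

Lemma sqn_real a : sqn (a%:C)%C = a ^+ 2.
Proof. by rewrite /sqn/= expr0n addr0. Qed.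

Lemma sqn0 : sqn 0 = 0 :> R.
Proof. by rewrite /sqn/= !expr0n addr0. Qed.

Lemma sqn_conj z : sqn (conjc z) = sqn z.
Proof. by case: z => a b; rewrite /sqn/= sqrrN. Qed.

Lemma cabs_ge0 z : 0 <= cabs z.
Proof. exact: sqrtr_ge0. Qed.

Lemma cabs_sqr z : cabs z ^+ 2 = sqn z.
Proof. by rewrite sqr_sqrtr// sqn_ge0. Qed.

Lemma cabsM z w : cabs (z * w) = cabs z * cabs w.
Proof.
apply/eqP; rewrite -(@eqrXn2 _ 2)// ?mulr_ge0 ?cabs_ge0//.
by rewrite exprMn !cabs_sqr sqnM.
Qed.

Lemma Re_le_cabs z : `|Re z| <= cabs z.
Proof.
by rewrite -(@ler_pXn2r _ 2) ?nnegrE ?cabs_ge0// real_normK ?num_real// cabs_sqr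
  /sqn lerDl sqr_ge0.
Qed.

Lemma Im_le_cabs z : `|Im z| <= cabs z.
Proof.
by rewrite -(@ler_pXn2r _ 2) ?nnegrE ?cabs_ge0// real_normK ?num_real// cabs_sqr
  /sqn lerDr sqr_ge0.
Qed.

Lemma cabs_le_sqn z : cabs z <= 1 + sqn z.
Proof. by have := cabs_ge0 z; rewrite -cabs_sqr; nra. Qed.

End complex_facts.

(** * Integrals of real and complex functions *)

Section integrals.
Context d (T : measurableType d) (R : realType).
Variable mu : {measure set T -> \bar R}.
Implicit Types (f g h : T -> R) (u v : T -> R[i]).

Definition rintegrable f := mu.-integrable setT (EFin \o f).

Lemma rintegrable_meas f : rintegrable f -> measurable_fun setT f.
Proof. by move=> /measurable_int/measurable_EFinP. Qed.

Lemma rintegrable_le f g : measurable_fun setT f -> (forall x, `|f x| <= g x) ->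
  rintegrable g -> rintegrable f.
Proof.
move=> mf fg; apply: le_integrable => //; first exact/measurable_EFinP.
by move=> x _; rewrite /= lee_fin (le_trans (fg x))// ler_norm.
Qed.

Lemma rintegrableD f g : rintegrable f -> rintegrable g ->
  rintegrable (fun x => f x + g x).
Proof. by move=> hf hg; exact: (integrableD _ hf hg). Qed.

Lemma rintegrableZ a f : rintegrable f -> rintegrable (fun x => a * f x).
Proof. by move=> hf; exact: (integrableZl _ _ hf). Qed.

Lemma rintegrableN f : rintegrable f -> rintegrable (fun x => - f x).
Proof. by move=> hf; exact: (integrableN hf). Qed.

Lemma rintegrableB f g : rintegrable f -> rintegrable g ->
  rintegrable (fun x => f x - g x).
Proof. by move=> hf hg; exact/rintegrableD/rintegrableN. Qed.

Lemma rintegrable_abs f : rintegrable f -> rintegrable (fun x => `|f x|).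
Proof. by move=> /integrable_norm. Qed.

Lemma rintegrable_sum (I : Type) (s : seq I) (F : I -> T -> R) :
  (forall i, rintegrable (F i)) -> rintegrable (fun x => \sum_(i <- s) F i x).
Proof.
move=> h; have := @integrable_sum _ _ _ mu _ measurableT _ s xpredT
  (fun i => EFin \o F i) (fun i _ => h i).
apply: eq_integrable => // x _.
by rewrite /= -sumEFin.
Qed.

Lemma Rintegral_sum (I : Type) (s : seq I) (F : I -> T -> R) :
  (forall i, rintegrable (F i)) ->
  \int[mu]_x (\sum_(i <- s) F i x) = \sum_(i <- s) \int[mu]_x F i x.
Proof.
move=> h; elim: s => [|i s ih].
  rewrite big_nil -[RHS](mul0r (fine (mu setT))) -Rintegral_cst//.
  by apply: eq_Rintegral => x _; rewrite big_nil.
rewrite big_cons -ih -RintegralD//; first last.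
- exact: rintegrable_sum.
- exact: h.
by apply: eq_Rintegral => x _; rewrite big_cons.
Qed.

Lemma rintegrable_ge0 f : measurable_fun setT f -> (forall x, 0 <= f x) ->
  (\int[mu]_x (f x)%:E < +oo)%E -> rintegrable f.
Proof.
move=> mf f0 foo; apply/integrableP; split; first exact/measurable_EFinP.
by under eq_integral do rewrite /= ger0_norm//.
Qed.

Lemma EFin_Rintegral f : rintegrable f ->
  (\int[mu]_x f x)%:E = (\int[mu]_x (f x)%:E)%E.
Proof. by move=> hf; rewrite /Rintegral fineK//; exact: (@integrable_fin_num _ _ _ mu setT). Qed.

Lemma le_Rint f g : rintegrable f -> rintegrable g -> (forall x, f x <= g x) ->
  \int[mu]_x f x <= \int[mu]_x g x.
Proof. by move=> hf hg fg; apply: le_Rintegral. Qed.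

(* [G] will be the image of a test function under the commutator, about whose
   measurability nothing is known: the integral of a nonnegative function is a
   supremum over the simple functions below it. *)
Lemma ge0_le_integral_nonmeas (F G : T -> \bar R) :
  (forall x, 0 <= F x)%E -> (forall x, F x <= G x)%E ->
  (\int[mu]_x F x <= \int[mu]_x G x)%E.
Proof.
move=> F0 FG; have G0 x : (0 <= G x)%E by exact: le_trans (F0 x) (FG x).
rewrite !ge0_integralTE//; apply: ge_ereal_sup => _ [h hF <-].
by apply: ereal_sup_ubound; exists h => // x; exact: le_trans (hF x) (FG x).
Qed.

Definition cmeas u := measurable_fun setT (fun x => Re (u x)) /\
  measurable_fun setT (fun x => Im (u x)).

Definition cintegrable u :=
  rintegrable (fun x => Re (u x)) /\ rintegrable (fun x => Im (u x)).

Definition Cint u : R[i] := Complex (\int[mu]_x Re (u x)) (\int[mu]_x Im (u x)).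

Lemma cmeasM u v : cmeas u -> cmeas v -> cmeas (fun x => u x * v x).
Proof.
move=> [ru iu] [rv iv]; split.
  under eq_fun do rewrite ReM.
  by apply: measurable_funB; apply: measurable_funM.
under eq_fun do rewrite ImM.
by apply: measurable_funD; apply: measurable_funM.
Qed.

Lemma cmeasB u v : cmeas u -> cmeas v -> cmeas (fun x => u x - v x).
Proof.
move=> [ru iu] [rv iv]; split.
  by under eq_fun do rewrite ReD ReN; exact: measurable_funB.
by under eq_fun do rewrite ImD ImN; exact: measurable_funB.
Qed.

Lemma cmeas_cst z : cmeas (fun=> z).
Proof. by split; exact: measurable_cst. Qed.

Lemma cmeas_real f : measurable_fun setT f -> cmeas (fun x => (f x)%:C%C).
Proof. by move=> mf; split => //=; exact: measurable_cst. Qed.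

Lemma cmeas_conj u : cmeas u -> cmeas (fun x => conjc (u x)).
Proof.
move=> [ru iu]; split.
  by rewrite (_ : (fun _ => _) = (fun x => Re (u x)))//; apply/funext => x; case: (u x).
rewrite (_ : (fun _ => _) = (fun x => - Im (u x))); first exact: measurable_funN.
by apply/funext => x; case: (u x).
Qed.

Lemma measurable_sqn u : cmeas u -> measurable_fun setT (fun x => sqn (u x)).
Proof. by move=> [ru iu]; apply: measurable_funD; apply: measurable_funX. Qed.

Lemma measurable_sqrt f : measurable_fun setT f ->
  measurable_fun setT (fun x => Num.sqrt (f x)).
Proof.
move=> mf; apply: (measurableT_comp _ mf).
apply: continuous_measurable_fun; exact: sqrt_continuous.
Qed.

Lemma measurable_cabs u : cmeas u -> measurable_fun setT (fun x => cabs (u x)).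
Proof. by move=> mu_; exact/measurable_sqrt/measurable_sqn. Qed.

(** On nonnegative reals inversion is the power with exponent -1, also at zero, where both give
    0. *)
Lemma measurable_inv f : measurable_fun setT f -> (forall x, 0 <= f x) ->
  measurable_fun setT (fun x => (f x)^-1).
Proof.
move=> mf f0; under eq_fun do rewrite -powR_inv1//.
exact: (measurableT_comp (@measurable_powR R (-1)) mf).
Qed.

Lemma cintegrable_meas u : cintegrable u -> cmeas u.
Proof. by move=> [ru iu]; split; exact: rintegrable_meas. Qed.

Lemma cintegrable_le u h : cmeas u -> (forall x, cabs (u x) <= h x) ->
  rintegrable h -> cintegrable u.
Proof.
move=> [ru iu] uh hh; split; apply: rintegrable_le hh => // x.
  exact: le_trans (Re_le_cabs _) (uh x).
exact: le_trans (Im_le_cabs _) (uh x).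
Qed.

Lemma cintegrableB u v : cintegrable u -> cintegrable v ->
  cintegrable (fun x => u x - v x).
Proof.
move=> [ru iu] [rv iv]; split.
  by under eq_fun do rewrite ReD ReN; exact: rintegrableB.
by under eq_fun do rewrite ImD ImN; exact: rintegrableB.
Qed.

Lemma cintegrableZ z u : cintegrable u -> cintegrable (fun x => z * u x).
Proof.
move=> [ru iu]; split.
  under eq_fun do rewrite ReM.
  by apply: rintegrableB; exact: rintegrableZ.
under eq_fun do rewrite ImM.
by apply: rintegrableD; exact: rintegrableZ.
Qed.

Lemma CintB u v : cintegrable u -> cintegrable v ->
  Cint (fun x => u x - v x) = Cint u - Cint v.
Proof.
move=> [ru iu] [rv iv]; apply: complex_eq; rewrite ReImE /=.
  by rewrite -RintegralB//; apply: eq_Rintegral => x _; rewrite ReD ReN.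
by rewrite -RintegralB//; apply: eq_Rintegral => x _; rewrite ImD ImN.
Qed.

Lemma CintZ z u : cintegrable u -> Cint (fun x => z * u x) = z * Cint u.
Proof.
move=> [ru iu]; apply: complex_eq; rewrite ReImE /=.
  rewrite -!RintegralZl// -RintegralB//; try exact: rintegrableZ.
  by apply: eq_Rintegral => x _; rewrite ReM.
rewrite -!RintegralZl// -RintegralD//; try exact: rintegrableZ.
by apply: eq_Rintegral => x _; rewrite ImM.
Qed.

End integrals.

(** * Product integrals and Fubini *)

Section product_integrals.
Context d (T : measurableType d) (R : realType).
Variable m : {sigma_finite_measure set T -> \bar R}.
Local Notation mm := (m \x m)%E.

Lemma measurable_fun_p1 (f : T -> R) : measurable_fun setT f ->
  measurable_fun [set: T * T] (fun p => f p.1).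
Proof. by move=> mf; exact: measurableT_comp mf measurable_fst. Qed.

Lemma measurable_fun_p2 (f : T -> R) : measurable_fun setT f ->
  measurable_fun [set: T * T] (fun p => f p.2).
Proof. by move=> mf; exact: measurableT_comp mf measurable_snd. Qed.

Lemma rintegrable_prod (f g : T -> R) : rintegrable m f -> rintegrable m g ->
  rintegrable mm (fun p => f p.1 * g p.2).
Proof.
move=> hf hg; apply/integrable12ltyP.
  apply/measurable_EFinP/measurable_funM.
    exact: (measurable_fun_p1 (rintegrable_meas hf)).
  exact: (measurable_fun_p2 (rintegrable_meas hg)).
rewrite (_ : (fun x => _) = fun x => ((\int[m]_y `|g y|) * `|f x|)%:E%E).
  by rewrite -EFin_Rintegral ?ltry//; exact/rintegrableZ/rintegrable_abs.
apply/funext => x; rewrite mulrC EFinM EFin_Rintegral; last exact: rintegrable_abs.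
rewrite -integralZl//; last exact: (rintegrable_abs hg).
by apply: eq_integral => y _; rewrite /= normrM.
Qed.

Lemma Rintegral_prod (f g : T -> R) : rintegrable m f -> rintegrable m g ->
  \int[mm]_p (f p.1 * g p.2) = (\int[m]_x f x) * (\int[m]_y g y).
Proof.
move=> hf hg; rewrite {1}/Rintegral -integral12_prod_meas1; last first.
  exact: rintegrable_prod.
rewrite -RintegralZr//; congr fine; apply: eq_integral => x _.
rewrite /fubini_F /= EFinM EFin_Rintegral// -integralZl//.
Qed.

Lemma rintegrable_prodC (u v : T -> R[i]) : cintegrable m u -> cintegrable m v ->
  rintegrable mm (fun p => Re (u p.1 * v p.2)).
Proof.
move=> [ru iu] [rv iv]; under eq_fun do rewrite ReM.
by apply: rintegrableB; [exact: (rintegrable_prod ru rv)|exact: (rintegrable_prod iu iv)].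
Qed.

Lemma Rintegral_prodC (u v : T -> R[i]) : cintegrable m u -> cintegrable m v ->
  \int[mm]_p Re (u p.1 * v p.2) = Re (Cint m u * Cint m v).
Proof.
move=> [ru iu] [rv iv]; rewrite ReM /= -!Rintegral_prod// -RintegralB//.
- by apply: eq_Rintegral => p _; rewrite ReM.
- exact: (rintegrable_prod ru rv).
- exact: (rintegrable_prod iu iv).
Qed.

Lemma Rintegral_fubini (F : T * T -> R) : rintegrable mm F ->
  \int[mm]_p F p = \int[m]_x \int[m]_y F (x, y).
Proof.
move=> hF; rewrite {1}/Rintegral -integral12_prod_meas1//.
(* The inner integral is finite only for almost every x; elsewhere [fine] sends it to 0, which
   affects a null set. *)
have /integrable_ae := integrable_fubini_F hF.
move=> /(_ measurableT) ae; congr fine; apply: ae_eq_integral => //.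
- exact: measurable_int (integrable_fubini_F hF).
- apply/measurable_EFinP; apply: measurableT_comp => //.
  exact: measurable_int (integrable_fubini_F hF).
- by apply: filterS ae => x /= h _; rewrite /fubini_F /Rintegral fineK// h.
Qed.

End product_integrals.

(** * Multipliers of the commutator kernel *)

Section bilinear_multipliers.
Context d (T : measurableType d) (R : realType).
Variable m : {sigma_finite_measure set T -> \bar R}.
Variables (Q : set T) (b1 b2 : T -> R[i]).
Hypotheses (mQ : measurable Q) (Qoo : (m Q < +oo)%E).
Local Notation mm := (m \x m)%E.
Implicit Types (f g : T -> R[i]) (rho : T * T -> R) (A : R).

Definition sqint f : R := \int[m]_x sqn (f x).

Definition test f := [/\ cmeas f, (exists M, forall x, cabs (f x) <= M) &
  forall x, ~ Q x -> f x = 0].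

(** [f] sits in the second variable and [g] in the first, with no conjugate. The real part suffices,
    since the main terms obtained at the end are real. *)
Definition hform f g (p : T * T) : R :=
  Re ((b1 p.1 - b1 p.2) * (b2 p.1 - b2 p.2) * (f p.2 * g p.1)).

Definition multbd rho := measurable_fun setT rho /\
  exists M, forall p, Q p.1 -> Q p.2 -> `|rho p| <= M.

(* Bounded real multipliers of the kernel; the right-hand side is quadratic, rather
   than a product of norms, so that bounds add up over orthogonal pieces. *)
Definition BD rho A := [/\ 0 <= A, multbd rho &
  forall f g, test f -> test g ->
    \int[mm]_p (rho p * hform f g p) <= A * (sqint f + sqint g)].

Definition sq_on (u : T -> R[i]) :=
  cmeas u /\ rintegrable m (fun x => \1_Q x * sqn (u x)).

(** What the four terms of [hformE] require; unlike [test], it admits unbounded functions. *)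
Definition good f := [/\ cintegrable m f, cintegrable m (fun x => b1 x * f x),
  cintegrable m (fun x => b2 x * f x) &
  cintegrable m (fun x => b1 x * b2 x * f x)].

Lemma rintegrable_indic : rintegrable m (\1_Q : T -> R).
Proof.
apply: rintegrable_ge0; first exact: measurable_indic.
  by move=> x; rewrite indicE.
by rewrite integral_indic// setIT.
Qed.

Lemma sq_on1 : sq_on (fun=> 1).
Proof.
split; first exact: cmeas_cst.
rewrite (_ : (fun _ => _) = \1_Q); first exact: rintegrable_indic.
by apply/funext => x; rewrite /sqn/= expr1n expr0n addr0 mulr1.
Qed.

(** On Q, |u f| <= M (1 + |u|^2), and Q has finite measure. *)
Lemma sq_on_integrable u f M : sq_on u -> cmeas f ->
  (forall x, cabs (f x) <= M * \1_Q x) -> cintegrable m (fun x => u x * f x).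
Proof.
move=> [mu iu] mf fM.
apply: (@cintegrable_le _ _ _ _ _ (fun x => M * (\1_Q x + \1_Q x * sqn (u x)))).
- exact: cmeasM.
- move=> x; rewrite cabsM.
  have [xQ|xQ] := boolP (x \in Q); have := fM x; rewrite indicE.
    rewrite xQ /= mulr1 mul1r => fxM.
    rewrite mulrC; apply: ler_pM; rewrite ?cabs_ge0 ?cabs_le_sqn//.
  rewrite (negbTE xQ) /= mulr0 => fx0.
  have -> : cabs (f x) = 0 by apply/eqP; rewrite eq_le fx0 cabs_ge0.
  by rewrite mulr0 mul0r addr0 mulr0.
- exact/rintegrableZ/rintegrableD/iu/rintegrable_indic.
Qed.

Lemma test_bound f : test f -> exists M, forall x, cabs (f x) <= M * \1_Q x.
Proof.
move=> [_ [M fM] f0]; exists M => x; rewrite indicE.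
have [xQ|xQ] := boolP (x \in Q); first by rewrite mulr1.
rewrite mulr0 f0 ?/cabs/= ?expr0n/= ?addr0 ?sqrtr0//.
by move=> /mem_set; exact/negP.
Qed.

Lemma testM f (a : T -> R) M : test f -> measurable_fun setT a ->
  (forall x, Q x -> `|a x| <= M) -> test (fun x => (a x)%:C%C * f x).
Proof.
move=> [mf [N fN] f0] ma aM; split.
- exact/cmeasM/mf/cmeas_real.
- exists (`|M| * `|N|) => x; rewrite cabsM.
  have [xQ|xQ] := pselect (Q x).
    rewrite ler_pM ?cabs_ge0 ?(le_trans (fN x) (ler_norm N))//.
    by rewrite /cabs /= expr0n addr0 sqrtr_sqr (le_trans (aM x xQ))// ler_norm.
  by rewrite f0// {2}/cabs/= expr0n/= addr0 sqrtr0 mulr0 mulr_ge0.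
- by move=> x xQ; rewrite f0// mulr0.
Qed.

Lemma rintegrable_sqn f : test f -> rintegrable m (fun x => sqn (f x)).
Proof.
move=> tf; have [M fM] := test_bound tf; have [mf _ _] := tf.
apply: (@rintegrable_le _ _ _ _ _ (fun x => M ^+ 2 * \1_Q x)).
- exact: measurable_sqn.
- move=> x; rewrite ger0_norm ?sqn_ge0// -cabs_sqr.
  rewrite (_ : \1_Q x = \1_Q x ^+ 2); last first.
    by rewrite indicE; case: (_ \in _); rewrite ?expr1n ?expr0n.
  by rewrite -exprMn lerXn2r// nnegrE ?cabs_ge0// (le_trans _ (fM x))// cabs_ge0.
- exact/rintegrableZ/rintegrable_indic.
Qed.

Lemma sqint_ge0 f : 0 <= sqint f.
Proof. by apply: Rintegral_ge0 => x _; exact: sqn_ge0. Qed.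

Lemma sqint_le f g : test f -> test g -> (forall x, sqn (f x) <= sqn (g x)) ->
  sqint f <= sqint g.
Proof. by move=> tf tg fg; apply: le_Rint => //; exact: rintegrable_sqn. Qed.

(** Real factors move between the test functions and the multiplier; the rules for [BD] that change
    [f] or [g] rest on this. *)
Lemma hformM f g (a c : T -> R) p :
  hform (fun x => (a x)%:C%C * f x) (fun x => (c x)%:C%C * g x) p =
  a p.2 * c p.1 * hform f g p.
Proof.
rewrite /hform; set k := (_ * _ in LHS).
rewrite !ReImE/=; ring.
Qed.

(** Multiplying out k(x,y) leaves products of a function of x and a function of y, whose double
    integrals factor. *)
Lemma hformE f g p : hform f g p =
  Re (b1 p.1 * b2 p.1 * g p.1 * f p.2) - Re (b1 p.1 * g p.1 * (b2 p.2 * f p.2))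
  - Re (b2 p.1 * g p.1 * (b1 p.2 * f p.2)) + Re (g p.1 * (b1 p.2 * b2 p.2 * f p.2)).
Proof. rewrite /hform !ReImE; ring. Qed.

Lemma hform_integrable f g : good f -> good g -> rintegrable mm (hform f g).
Proof.
move=> [f1 f2 f3 f4] [g1 g2 g3 g4].
rewrite (_ : hform f g = fun p => hform f g p)//; under eq_fun do rewrite hformE.
apply: rintegrableD; [apply: rintegrableB; [apply: rintegrableB|]|].
- exact: (rintegrable_prodC g4 f1).
- exact: (rintegrable_prodC g2 f3).
- exact: (rintegrable_prodC g3 f2).
- exact: (rintegrable_prodC g1 f4).
Qed.

Lemma Rintegral_hform f g : good f -> good g -> \int[mm]_p hform f g p =
  Re (Cint m (fun x => b1 x * b2 x * g x) * Cint m f)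
  - Re (Cint m (fun x => b1 x * g x) * Cint m (fun x => b2 x * f x))
  - Re (Cint m (fun x => b2 x * g x) * Cint m (fun x => b1 x * f x))
  + Re (Cint m g * Cint m (fun x => b1 x * b2 x * f x)).
Proof.
move=> [f1 f2 f3 f4] [g1 g2 g3 g4].
have i1 := rintegrable_prodC g4 f1; have i2 := rintegrable_prodC g2 f3.
have i3 := rintegrable_prodC g3 f2; have i4 := rintegrable_prodC g1 f4.
have i12 := rintegrableB i1 i2; have i123 := rintegrableB i12 i3.
rewrite -(Rintegral_prodC g4 f1) -(Rintegral_prodC g2 f3).
rewrite -(Rintegral_prodC g3 f2) -(Rintegral_prodC g1 f4).
rewrite -(RintegralB measurableT i1 i2) -(RintegralB measurableT i12 i3).
rewrite -(RintegralD measurableT i123 i4).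
by apply: eq_Rintegral => p _; rewrite hformE.
Qed.

Hypotheses (hb1 : sq_on b1) (hb2 : sq_on b2) (hb12 : sq_on (fun x => b1 x * b2 x)).

Lemma test_good f : test f -> good f.
Proof.
move=> tf; have [M fM] := test_bound tf; have [mf _ _] := tf.
split; try exact: (sq_on_integrable _ mf fM).
have := sq_on_integrable sq_on1 mf fM.
by under eq_fun do rewrite mul1r.
Qed.

Lemma hform0 f g p : test f -> test g -> ~ (Q p.1 /\ Q p.2) -> hform f g p = 0.
Proof.
move=> [_ _ f0] [_ _ g0] nQ; rewrite /hform.
have [q1|q1] := pselect (Q p.1); last by rewrite g0// !mulr0.
by rewrite f0 ?mul0r ?mulr0// => q2; exact: nQ.
Qed.

Lemma multbd_integrable rho f g : multbd rho -> test f -> test g ->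
  rintegrable mm (fun p => rho p * hform f g p).
Proof.
move=> [mrho [M rhoM]] tf tg.
have ih := hform_integrable (test_good tf) (test_good tg).
apply: (@rintegrable_le _ _ _ _ _ (fun p => M * `|hform f g p|)).
- by apply: measurable_funM => //; exact: rintegrable_meas ih.
- move=> p; have [[q1 q2]|nq] := pselect (Q p.1 /\ Q p.2).
    by rewrite normrM ler_wpM2r// rhoM.
  by rewrite hform0// mulr0 normr0 mulr0.
- exact/rintegrableZ/rintegrable_abs.
Qed.

Lemma BD_eq rho rho' A : BD rho A -> (forall p, Q p.1 -> Q p.2 -> rho p = rho' p) ->
  measurable_fun setT rho' -> BD rho' A.
Proof.
move=> [A0 [mrho [M rhoM]] h] e mrho'; split => //.
  by split => //; exists M => p q1 q2; rewrite -e// rhoM.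
move=> f g tf tg; rewrite (le_trans _ (h f g tf tg))// le_eqVlt; apply/orP; left.
apply/eqP/eq_Rintegral => p _; have [[q1 q2]|nq] := pselect (Q p.1 /\ Q p.2).
  by rewrite e.
by rewrite hform0// !mulr0.
Qed.

Lemma BD_le rho A A' : BD rho A -> A <= A' -> BD rho A'.
Proof.
move=> [A0 brho h] AA'; split; [exact: le_trans AA'|by []|] => f g tf tg.
by rewrite (le_trans (h f g tf tg))// ler_wpM2r// addr_ge0// sqint_ge0.
Qed.

Lemma multbdZ c rho : multbd rho -> multbd (fun p => c * rho p).
Proof.
move=> [mrho [M rhoM]]; split; first exact: measurable_funM.
by exists (`|c| * M) => p q1 q2; rewrite normrM ler_wpM2l// rhoM.
Qed.

Lemma multbd_prod rho (a c : T -> R) M N : multbd rho ->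
  measurable_fun setT a -> measurable_fun setT c ->
  (forall x, Q x -> `|a x| <= M) -> (forall x, Q x -> `|c x| <= N) ->
  multbd (fun p => a p.2 * c p.1 * rho p).
Proof.
move=> [mrho [K rhoK]] ma mc aM cN; split.
  apply: measurable_funM => //; apply: measurable_funM.
    exact: measurable_fun_p2.
  exact: measurable_fun_p1.
exists (M * N * K) => p q1 q2; rewrite !normrM.
by rewrite !ler_pM ?mulr_ge0 ?aM ?cN ?rhoK.
Qed.

Lemma BDZ c rho A : 0 <= c -> BD rho A -> BD (fun p => c * rho p) (c * A).
Proof.
move=> c0 [A0 brho h]; split; [exact: mulr_ge0|exact: multbdZ|].
move=> f g tf tg; rewrite -mulrA (le_trans _ (ler_wpM2l c0 (h f g tf tg)))//.
rewrite -RintegralZl//; last exact: multbd_integrable.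
by under eq_Rintegral do rewrite -mulrA.
Qed.

Lemma BD_sum (I : eqType) (s : seq I) (rho : I -> T * T -> R) (A : I -> R) :
  (forall i, BD (rho i) (A i)) ->
  BD (fun p => \sum_(i <- s) rho i p) (\sum_(i <- s) A i).
Proof.
move=> h; split.
- by apply: sumr_ge0 => i _; case: (h i).
- split; first by apply: measurable_sum => i; have [_ []] := h i.
  elim: s => [|i s [M ih]]; first by exists 0 => p _ _; rewrite big_nil normr0.
  have [_ [_ [N hN]] _] := h i; exists (N + M) => p q1 q2.
  by rewrite big_cons (le_trans (ler_normD _ _))// lerD ?hN ?ih.
- move=> f g tf tg; under eq_Rintegral do rewrite mulr_suml.
  rewrite Rintegral_sum; last first.
    by move=> i; apply: multbd_integrable => //; case: (h i).
  by rewrite mulr_suml; apply: ler_sum => i _; have [_ _] := h i; exact.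
Qed.

Lemma BDD rho1 rho2 A1 A2 : BD rho1 A1 -> BD rho2 A2 ->
  BD (fun p => rho1 p + rho2 p) (A1 + A2).
Proof.
move=> h1 h2; have := @BD_sum _ [:: true; false]
  (fun b => if b then rho1 else rho2) (fun b => if b then A1 else A2).
rewrite !big_cons big_nil addr0 => h.
have {}h : BD (fun p => \sum_(i <- [:: true; false]) (if i then rho1 else rho2) p)
    (A1 + A2) by apply: h; case.
apply: (BD_eq h) => [p _ _|]; first by rewrite !big_cons big_nil addr0.
by apply: measurable_funD; [have [_ []] := h1|have [_ []] := h2].
Qed.

Lemma sqn_realM (a : R) z : sqn (a%:C%C * z) = a ^+ 2 * sqn z.
Proof. by rewrite sqnM sqn_real. Qed.

(* The bounds for the pairs [(phi_i f, phi_i g)] add up to the one for [(f, g)]. *)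
Lemma BD_schur (I : finType) (phi : I -> T -> R) rho A :
  (forall i, measurable_fun setT (phi i)) ->
  (forall x, Q x -> \sum_i phi i x ^+ 2 <= 1) ->
  BD rho A -> BD (fun p => (\sum_i phi i p.1 * phi i p.2) * rho p) A.
Proof.
move=> mphi phi1 [A0 brho h].
have phile i x : Q x -> `|phi i x| <= 1.
  move=> qx; rewrite -(@ler_pXn2r _ 2)// ?nnegrE// real_normK ?num_real// expr1n.
  apply: le_trans (phi1 x qx); rewrite (bigD1 i)//= lerDl.
  by apply: sumr_ge0 => j _; exact: sqr_ge0.
have bi i : multbd (fun p => phi i p.2 * phi i p.1 * rho p).
  exact: (multbd_prod brho (mphi i) (mphi i) (phile i) (phile i)).
have e p : (\sum_i phi i p.1 * phi i p.2) * rho p =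
    \sum_i (phi i p.2 * phi i p.1 * rho p).
  by rewrite mulr_suml; apply: eq_bigr => i _; rewrite (mulrC (phi i p.1)).
have mrhos : measurable_fun setT (fun p => (\sum_i phi i p.1 * phi i p.2) * rho p).
  under eq_fun do rewrite e; apply: measurable_sum => i; by have [] := bi i.
split => //.
- split => //; have [_ [M rhoM]] := brho.
  exists (\sum_(i : I) M) => p q1 q2; rewrite e (le_trans (ler_norm_sum _ _ _))//.
  apply: ler_sum => i _; rewrite !normrM -[M]mul1r ler_pM ?mulr_ge0 ?rhoM//.
  by rewrite mulr_ile1 ?phile.
- move=> f g tf tg.
  have tphi i u : test u -> test (fun x => (phi i x)%:C%C * u x).
    by move=> tu; apply: (testM tu (mphi i) (phile i)).
  under eq_Rintegral do rewrite e mulr_suml.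
  rewrite Rintegral_sum; last by move=> i; exact: multbd_integrable.
  have sumle u : test u -> \sum_i sqint (fun x => (phi i x)%:C%C * u x) <= sqint u.
    move=> tu; rewrite /sqint -Rintegral_sum; last first.
      by move=> i; exact/rintegrable_sqn/tphi.
    apply: le_Rint; [|exact: rintegrable_sqn|].
      by apply: rintegrable_sum => i; exact/rintegrable_sqn/tphi.
    move=> x; under eq_bigr do rewrite sqn_realM.
    rewrite -mulr_suml; have [qx|qx] := pselect (Q x).
      by rewrite -[leRHS]mul1r ler_wpM2r ?sqn_ge0// phi1.
    by have [_ _ ->] := tu; rewrite // sqn0 mulr0.
  apply: (@le_trans _ _ (\sum_i A * (sqint (fun x => (phi i x)%:C%C * f x) +
      sqint (fun x => (phi i x)%:C%C * g x)))).
    apply: ler_sum => i _; apply: le_trans (h _ _ (tphi i f tf) (tphi i g tg)).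
    rewrite le_eqVlt; apply/orP; left; apply/eqP/eq_Rintegral => p _.
    by rewrite hformM; ring.
  by rewrite -mulr_sumr ler_wpM2l// big_split lerD// sumle.
Qed.

(** Multiplying [f] by [a] and [g] by [c] does not increase their norms. The two factors may differ,
    unlike in [BD_schur]. *)
Lemma BD_mul (a c : T -> R) rho A : measurable_fun setT a -> measurable_fun setT c ->
  (forall x, Q x -> `|a x| <= 1) -> (forall x, Q x -> `|c x| <= 1) ->
  BD rho A -> BD (fun p => a p.2 * c p.1 * rho p) A.
Proof.
move=> ma mc a1 c1 [A0 brho h]; split => //.
  exact: (multbd_prod brho ma mc a1 c1).
move=> f g tf tg.
have ta := testM tf ma a1; have tc := testM tg mc c1.
have sl u (v : T -> R) : test u -> measurable_fun setT v -> (forall x, Q x -> `|v x| <= 1) ->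
    sqint (fun x => (v x)%:C%C * u x) <= sqint u.
  move=> tu mv v1; apply: sqint_le => //; first exact: testM v1.
  move=> x; rewrite sqn_realM; have [qx|qx] := pselect (Q x).
    rewrite -[leRHS]mul1r ler_wpM2r ?sqn_ge0// -real_normK ?num_real//.
    by rewrite exprn_ile1 ?v1.
  by have [_ _ ->] := tu; rewrite // sqn0 mulr0.
apply: (@le_trans _ _ (A * (sqint (fun x => (a x)%:C%C * f x) +
   sqint (fun x => (c x)%:C%C * g x)))); last first.
  by rewrite ler_wpM2l// lerD// sl.
apply: le_trans (h _ _ ta tc).
rewrite le_eqVlt; apply/orP; left; apply/eqP/eq_Rintegral => p _.
by rewrite hformM; ring.
Qed.

Lemma Rintegral_lim_le (F : nat -> T * T -> R) (G H : T * T -> R) B :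
  (forall n, measurable_fun setT (F n)) -> measurable_fun setT G ->
  rintegrable mm H -> (forall n p, `|F n p| <= H p) ->
  {ae mm, forall p, (fun n => F n p) @ \oo --> G p} ->
  (forall n, \int[mm]_p F n p <= B) -> \int[mm]_p G p <= B.
Proof.
move=> mF mG iH FH cv hB.
have iF n : rintegrable mm (F n) by apply: rintegrable_le (mF n) (FH n) iH.
have cvE : {ae mm, forall p, setT p -> (fun n => (F n p)%:E) @ \oo --> (G p)%:E}.
  apply: filterS cv => p h _; apply: cvg_EFin => //.
  by apply: nearW => n.
have [iG _ cvI] := @dominated_convergence _ _ _ mm setT measurableT
  (fun n => EFin \o F n) (EFin \o G) (EFin \o H)
  (fun n => (measurable_EFinP _ _).2 (mF n)) ((measurable_EFinP _ _).2 mG) cvE iH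
  (aeW _ (fun p n _ => FH n p)).
rewrite -lee_fin EFin_Rintegral//; apply: (lee_cvg_to cvI (cvg_cst B%:E)).
by apply: nearW => n /=; rewrite -(EFin_Rintegral (iF n)) lee_fin.
Qed.

(** Dominated convergence, with M times the modulus of the integrable form as majorant. *)
Lemma BD_lim (rho_ : nat -> T * T -> R) rho A M :
  (forall n, BD (rho_ n) A) ->
  (forall n p, Q p.1 -> Q p.2 -> `|rho_ n p| <= M) ->
  multbd rho ->
  {ae mm, forall p, Q p.1 -> Q p.2 -> (fun n => rho_ n p) @ \oo --> rho p} ->
  BD rho A.
Proof.
move=> h hM brho cv; have [A0 _ _] := h 0%N; split => // f g tf tg.
have ih := hform_integrable (test_good tf) (test_good tg).
apply: (@Rintegral_lim_le (fun n p => rho_ n p * hform f g p) _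
  (fun p => M * `|hform f g p|)).
- move=> n; apply: measurable_funM; last exact: rintegrable_meas ih.
  by have [_ []] := h n.
- by apply: measurable_funM; [case: brho|exact: rintegrable_meas ih].
- exact/rintegrableZ/rintegrable_abs.
- move=> n p; have [[q1 q2]|nq] := pselect (Q p.1 /\ Q p.2).
    by rewrite normrM ler_wpM2r// hM.
  by rewrite hform0// mulr0 normr0 mulr0.
- apply: filterS cv => p hp; have [[q1 q2]|nq] := pselect (Q p.1 /\ Q p.2).
    by apply: cvgM; [exact: hp|exact: cvg_cst].
  by rewrite hform0// mulr0; under eq_fun do rewrite mulr0; exact: cvg_cst.
- by move=> n; have [_ _] := h n; exact.
Qed.

Lemma measurable_cabs_le f (r : R) : cmeas f -> measurable [set x | cabs (f x) <= r].
Proof.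
move=> mf; have := measurable_cabs mf measurableT (measurable_itv `]-oo, r]).
by rewrite setTI; congr (measurable _).
Qed.

Lemma trunc_cvg f x :
  (fun n => \1_[set x | cabs (f x) <= n%:R] x : R) @ \oo --> (1 : R).
Proof.
apply: cvg_near_cst; exists (Num.truncn (cabs (f x))).+1 => // n /= hn.
rewrite indicE mem_set//=; apply: ltW.
by rewrite (lt_le_trans (truncnS_gt _))// ler_nat.
Qed.

(** Truncating [f] and [g] at height n gives test functions, to which the bound applies; dominated
    convergence then reaches the unbounded functions needed at the end, such as conjugates of the
    symbols. *)
Lemma BD1_L2 A f g : BD (fun=> 1) A -> good f -> good g ->
  (forall x, ~ Q x -> f x = 0) -> (forall x, ~ Q x -> g x = 0) ->
  rintegrable m (fun x => sqn (f x)) -> rintegrable m (fun x => sqn (g x)) ->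
  \int[mm]_p hform f g p <= A * (sqint f + sqint g).
Proof.
move=> [A0 _ h] gf gg f0 g0 if2 ig2.
have mf : cmeas f by case: gf => /cintegrable_meas.
have mg : cmeas g by case: gg => /cintegrable_meas.
pose X (u : T -> R[i]) n : T -> R := \1_[set x | cabs (u x) <= n%:R].
have mX u n : cmeas u -> measurable_fun setT (X u n).
  by move=> cu; apply: measurable_indic; exact: measurable_cabs_le.
have X1 u n x : 0 <= X u n x <= 1 by rewrite /X indicE; case: (_ \in _); rewrite /= ?lexx ?ler01.
have tX u n : cmeas u -> (forall x, ~ Q x -> u x = 0) ->
    test (fun x => (X u n x)%:C%C * u x).
  move=> mu u0; split; first exact/cmeasM/mu/cmeas_real/mX.
    exists n%:R => x; rewrite cabsM {1}/cabs/= expr0n/= addr0 sqrtr_sqr.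
    rewrite /X indicE; case: (boolP (_ \in _)) => [|_].
      by rewrite inE/= normr1 mul1r.
    by rewrite normr0 mul0r ler0n.
  by move=> x qx; rewrite u0// mulr0.
have ih := hform_integrable gf gg.
apply: (@Rintegral_lim_le (fun n p => X f n p.2 * X g n p.1 * hform f g p) _
  (fun p => `|hform f g p|)).
- move=> n; apply: measurable_funM; last exact: rintegrable_meas ih.
  apply: measurable_funM; [apply: measurable_fun_p2|apply: measurable_fun_p1];
  exact: mX.
- exact: rintegrable_meas ih.
- exact: rintegrable_abs.
- move=> n p; rewrite normrM -[leRHS]mul1r ler_wpM2r// normrM.
  have /andP[a0 a1] := X1 f n p.2; have /andP[c0 c1] := X1 g n p.1.
  by rewrite !ger0_norm// mulr_ile1.
- apply: aeW => p.
  suff : (fun n => X f n p.2 * X g n p.1 * hform f g p) @ \oo --> 1 * 1 * hform f g p.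
    by rewrite !mul1r.
  by apply: cvgM; [apply: cvgM; exact: trunc_cvg|exact: cvg_cst].
- move=> n; apply: (@le_trans _ _ (A * (sqint (fun x => (X f n x)%:C%C * f x) +
      sqint (fun x => (X g n x)%:C%C * g x)))).
    apply: le_trans (h _ _ (tX f n mf f0) (tX g n mg g0)).
    rewrite le_eqVlt; apply/orP; left; apply/eqP/eq_Rintegral => p _.
    by rewrite hformM mul1r.
  have sl u : cmeas u -> (forall x, ~ Q x -> u x = 0) ->
      rintegrable m (fun x => sqn (u x)) ->
      sqint (fun x => (X u n x)%:C%C * u x) <= sqint u.
    move=> mu u0 iu; apply: le_Rint => //; first exact/rintegrable_sqn/tX.
    move=> x; rewrite sqn_realM -[leRHS]mul1r ler_wpM2r ?sqn_ge0//.
    by have /andP[? ?] := X1 u n x; rewrite exprn_ile1.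
  by rewrite ler_wpM2l// lerD// sl.
Qed.

End bilinear_multipliers.

(** Optimising over the scaling t turns a bound by a sum of squared norms into one by their
    product. *)
Lemma quadratic_discriminant (R : realType) (h A F G : R) : 0 <= A -> 0 <= F ->
  0 <= G -> (forall t, t * h <= A * (t ^+ 2 * F + G)) -> h ^+ 2 <= 4 * A ^+ 2 * (F * G).
Proof.
move=> A0 F0 G0 H.
have [AF|AF] := leP (A * F) 0.
  have {AF} AF : A * F = 0 by apply/eqP; rewrite eq_le AF mulr_ge0.
  suff -> : h = 0 by rewrite expr0n/= !mulr_ge0// sqr_ge0.
  apply/eqP/negPn/negP => h0.
  (* Without a quadratic term the right-hand side is constant in t; this t makes the left-hand side
     [A * G + 1]. *)
  have := H ((A * G + 1) / h); rewrite divfK// mulrDr mulrCA AF mulr0 add0r.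
  by rewrite gerDl ler10.
(* The maximiser of t h - A F t^2. *)
pose t := h / (2 * (A * F)).
have ht : h = 2 * (A * F) * t by rewrite mulrC divfK// gt_eqF// mulr_gt0.
have Ht := H t; rewrite {1}ht in Ht.
have {}Ht : A * F * t ^+ 2 <= A * G by nra.
rewrite ht (_ : (_ * t) ^+ 2 = 4 * (A * F) * (A * F * t ^+ 2)); last by ring.
rewrite (_ : 4 * A ^+ 2 * (F * G) = 4 * (A * F) * (A * G)); last by ring.
by rewrite ler_wpM2l// mulr_ge0// ltW.
Qed.

(** * The oscillation bounds for mean-zero symbols *)

Section mean_zero.
Context d (T : measurableType d) (R : realType).
Variable m : {sigma_finite_measure set T -> \bar R}.
Variables (Q : set T) (b1 b2 : T -> R[i]).
Hypotheses (mQ : measurable Q) (Qoo : (m Q < +oo)%E).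
Local Notation mm := (m \x m)%E.
Local Notation sq_on := (sq_on m Q).
Local Notation good := (good m b1 b2).
Hypotheses (hb1 : sq_on b1) (hb2 : sq_on b2) (hb12 : sq_on (fun x => b1 x * b2 x)).

(** The cut-off supplies the support condition of [BD1_L2]; [wconj (fun=> 1)] is the indicator of
    Q. *)
Definition wconj (v : T -> R[i]) (x : T) : R[i] := (\1_Q x)%:C%C * conjc (v x).

Lemma cabs_conj (z : R[i]) : cabs (conjc z) = cabs z.
Proof. by case: z => a b; rewrite /cabs/= sqrrN. Qed.

Lemma cmeas_wconj v : cmeas v -> cmeas (wconj v).
Proof.
move=> mv; apply: cmeasM; last exact: cmeas_conj.
exact/cmeas_real/measurable_indic.
Qed.

Lemma cintegrable_wconj u v : sq_on u -> sq_on v ->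
  cintegrable m (fun x => u x * wconj v x).
Proof.
move=> [mu iu] [mv iv].
apply: (@cintegrable_le _ _ _ _ _
  (fun x => \1_Q x * sqn (u x) + \1_Q x * sqn (v x))).
- exact/cmeasM/cmeas_wconj.
- move=> x; rewrite !cabsM cabs_conj -mulrDr {2}/cabs/= expr0n addr0 sqrtr_sqr.
  rewrite indicE; case: (_ \in _); last by rewrite normr0 mul0r !mulr0 mul0r.
  rewrite normr1 !mul1r -!cabs_sqr.
  have := cabs_ge0 (u x); have := cabs_ge0 (v x); nra.
- exact: rintegrableD.
Qed.

Lemma cintegrable_wconj1 v : sq_on v -> cintegrable m (wconj v).
Proof.
move=> hv; have := cintegrable_wconj (sq_on1 mQ Qoo) hv.
by under eq_fun do rewrite mul1r.
Qed.

Lemma good_wconj v : sq_on v -> good (wconj v).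
Proof.
by move=> hv; split; [exact: cintegrable_wconj1|exact: cintegrable_wconj..].
Qed.

Lemma Cint_conj (u : T -> R[i]) : cintegrable m u ->
  Cint m (fun x => conjc (u x)) = conjc (Cint m u).
Proof.
move=> [ru iu]; apply: complex_eq => /=.
  by apply: eq_Rintegral => x _; case: (u x).
rewrite -mulN1r -RintegralZl//; apply: eq_Rintegral => x _.
by rewrite mulN1r; case: (u x).
Qed.

Lemma wconjC u v x : u x * wconj v x = conjc (v x * wconj u x).
Proof. by rewrite /wconj; apply: complex_eq; case: (u x) (v x) => [a b] [c e]/=; ring. Qed.

Lemma Cint_wconjC u v : sq_on u -> sq_on v ->
  Cint m (fun x => u x * wconj v x) = conjc (Cint m (fun x => v x * wconj u x)).
Proof.
move=> hu hv; rewrite -Cint_conj; last exact: cintegrable_wconj.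
by congr (Cint m _); apply/funext => x; rewrite -wconjC.
Qed.

Lemma sqn_wconj v x : sqn (wconj v x) = \1_Q x * sqn (v x).
Proof.
rewrite sqnM sqn_real sqn_conj; congr (_ * _).
by rewrite indicE; case: (_ \in _); rewrite ?expr1n ?expr0n.
Qed.

Definition sqQ v := \int[m]_x (\1_Q x * sqn (v x)).

Lemma sqQ_ge0 v : 0 <= sqQ v.
Proof. by apply: Rintegral_ge0 => x _; rewrite mulr_ge0 ?sqn_ge0// indicE. Qed.

Lemma sqQ1 : sqQ (fun=> 1) = fine (m Q).
Proof.
rewrite -[RHS]mul1r -Rintegral_cst// Rintegral_mkcond.
apply: eq_Rintegral => x _; rewrite patchE indicE /sqn/= expr0n addr0 expr1n mulr1.
by case: (_ \in _).
Qed.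

Lemma Cint_wconj_diag v : Cint m (fun x => v x * wconj v x) = ((sqQ v)%:C)%C.
Proof.
apply: complex_eq => /=.
  by apply: eq_Rintegral => x _; rewrite /wconj/sqn; case: (v x) => a b /=; ring.
rewrite -[RHS](mul0r (fine (m setT))) -Rintegral_cst//.
by apply: eq_Rintegral => x _; rewrite /wconj; case: (v x) => a b /=; ring.
Qed.

(** Scaling only the first function by t, then optimising in t, gives a bound of Cauchy-Schwarz
    type. *)
Lemma hform_wconj_discr A u v : BD m Q b1 b2 (fun=> 1) A -> sq_on u -> sq_on v ->
  (\int[mm]_p hform b1 b2 (wconj u) (wconj v) p) ^+ 2 <= 4 * A ^+ 2 * (sqQ u * sqQ v).
Proof.
move=> hBD hu hv; have [A0 _ _] := hBD.
apply: quadratic_discriminant; rewrite ?sqQ_ge0// => t.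
have gu := good_wconj hu; have gv := good_wconj hv.
pose f x := (t%:C)%C * wconj u x.
have gf : good f.
  have [h1 h2 h3 h4] := gu; split; first exact: cintegrableZ.
  - by under eq_fun do rewrite mulrCA; exact: cintegrableZ.
  - by under eq_fun do rewrite mulrCA; exact: cintegrableZ.
  - by under eq_fun do rewrite mulrCA; exact: cintegrableZ.
have w0 w x : ~ Q x -> wconj w x = 0.
  by move=> nQ; rewrite /wconj indicE memNset// mul0r.
have sw w : sq_on w -> rintegrable m (fun x => sqn (wconj w x)).
  by move=> [_ iw]; under eq_fun do rewrite sqn_wconj.
have sf : rintegrable m (fun x => sqn (f x)).
  by under eq_fun do rewrite sqn_realM; exact/rintegrableZ/sw.
have := BD1_L2 mQ Qoo hBD gf gv _ (w0 v) sf (sw v hv).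
have -> : sqint m f = t ^+ 2 * sqQ u.
  rewrite /sqint /sqQ -RintegralZl//; last by case: hu.
  by apply: eq_Rintegral => x _; rewrite sqn_realM sqn_wconj.
have -> : sqint m (wconj v) = sqQ v.
  by apply: eq_Rintegral => x _; rewrite sqn_wconj.
have -> : \int[mm]_p hform b1 b2 f (wconj v) p =
    t * \int[mm]_p hform b1 b2 (wconj u) (wconj v) p.
  rewrite -RintegralZl//; last exact: (hform_integrable gu gv).
  apply: eq_Rintegral => p _.
  have := @hformM _ _ _ b1 b2 (wconj u) (wconj v) (fun=> t) (fun=> 1) p.
  rewrite mulr1 => <-; congr (hform _ _ _ _ _).
  by apply/funext => x; rewrite mul1r.
by apply => x nQ; rewrite /f w0// mulr0.
Qed.

Hypotheses (m1 : Cint m (fun x => b1 x * wconj (fun=> 1) x) = 0)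
           (m2 : Cint m (fun x => b2 x * wconj (fun=> 1) x) = 0).

Lemma Cint_wconj1 v : sq_on v ->
  Cint m (wconj v) = conjc (Cint m (fun x => v x * wconj (fun=> 1) x)).
Proof.
move=> hv; rewrite -(Cint_wconjC (sq_on1 mQ Qoo) hv).
by congr (Cint m _); apply/funext => x; rewrite mul1r.
Qed.

(** Squaring x <= |h| gives x^2 <= K x, and one factor x cancels. *)
Lemma sqr_le_cancel (x h K : R) : 0 <= x -> x <= `|h| -> h ^+ 2 <= K * x -> 0 <= K ->
  x <= K.
Proof.
move=> x0 xh hK K0; have [->//|xn0] := eqVneq x 0.
have xp : 0 < x by rewrite lt_neqAle eq_sym xn0.
rewrite -(ler_pM2r xp) -expr2 (le_trans _ hK)// -(real_normK (num_real h)).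
by rewrite lerXn2r// nnegrE.
Qed.

(** Take f = 1 and g = conj(b1 b2) on Q. The two middle terms vanish because the symbols have mean
    zero; the last one is the squared modulus of the integral of b1 b2, which only helps. *)
Lemma mean_zero_product_bound A : BD m Q b1 b2 (fun=> 1) A ->
  fine (m Q) * sqQ (fun x => b1 x * b2 x) <= 4 * A ^+ 2.
Proof.
move=> hBD; have h1 := sq_on1 mQ Qoo.
have := hform_wconj_discr hBD h1 hb12.
rewrite sqQ1 => h; apply: (sqr_le_cancel _ _ h) => //.
- by rewrite mulr_ge0 ?sqQ_ge0// fine_ge0.
- rewrite (Rintegral_hform (good_wconj h1) (good_wconj hb12)).
  rewrite m1 m2 !mulr0 !subr0 (Cint_wconj_diag (fun x => b1 x * b2 x)).
  rewrite (Cint_wconj1 hb12) (Cint_wconj1 h1) (Cint_wconj_diag (fun=> 1)).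
  rewrite sqQ1; set X := sqQ _; set z := Cint _ _.
  apply: le_trans (ler_norm _); rewrite mulrC.
  by case: z => p q /=; nra.
- by rewrite mulr_ge0// sqr_ge0.
Qed.

(** Take f = conj(b1) and g = conj(b2) on Q. The two outer terms vanish by the mean-zero hypotheses.
    The others are minus the squared modulus of the integral of b1 conj(b2) and minus the main
    product, so they cannot cancel. *)
Lemma mean_zero_square_bound A : BD m Q b1 b2 (fun=> 1) A ->
  sqQ b1 * sqQ b2 <= 4 * A ^+ 2.
Proof.
move=> hBD; have h := hform_wconj_discr hBD hb1 hb2.
apply: (sqr_le_cancel _ _ h) => //.
- by rewrite mulr_ge0 ?sqQ_ge0.
- rewrite (Rintegral_hform (good_wconj hb1) (good_wconj hb2)).
  rewrite (Cint_wconj1 hb1) (Cint_wconj1 hb2) m1 m2 conjc0 mulr0 mul0r.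
  rewrite !Cint_wconj_diag (Cint_wconjC hb1 hb2).
  set z := Cint _ _; rewrite -normrN; apply: le_trans (ler_norm _).
  by case: z => p q /=; nra.
- by rewrite mulr_ge0// sqr_ge0.
Qed.

End mean_zero.

(** * An iteration for 1 - sqrt(1 - t) *)

Section sqrt_iteration.
Context {R : realType}.
Implicit Types t : R.

(* Converges to [1 - sqrt (1 - t)], the fixed point of [q = (t + q^2) / 2]. *)
Fixpoint qit t n : R := if n is n'.+1 then (t + qit t n' ^+ 2) / 2 else 0.

Lemma qit_le1 t n : `|t| <= 1 -> `|qit t n| <= 1.
Proof.
move=> t1; elim: n => [|n ih]; first by rewrite normr0.
rewrite /= normrM (@ger0_norm _ 2^-1)// ler_pdivrMr// mul1r.
rewrite (le_trans (ler_normD _ _))// -[2]/(1 + 1) lerD// normrX exprn_ile1//.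
Qed.

(** With r the limit, q_(n+1) - r = (q_n + r)/2 (q_n - r), so errors shrink by the factor (1 +
    |r|)/2. It is below 1 because t < 1 gives r < 1 and t >= -1 gives r > -1. *)
Lemma qit_cvg t : `|t| <= 1 -> t < 1 ->
  (fun n => qit t n) @ \oo --> (1 - Num.sqrt (1 - t)).
Proof.
move=> t1 tl1; set s := Num.sqrt (1 - t); set r := 1 - s.
have s0 : 0 < s by rewrite sqrtr_gt0 subr_gt0.
have ss : s ^+ 2 = 1 - t by rewrite sqr_sqrtr// subr_ge0 ltW.
have s2 : s < 2 by move: t1; rewrite ler_norml => /andP[t1 _]; nra.
have r1 : `|r| < 1 by rewrite ltr_norml /r; apply/andP; split; lra.
have rE : r = (t + r ^+ 2) / 2 by rewrite /r; apply: (mulIf (x := 2)) => //; rewrite divfK//; nra.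
pose th := (1 + `|r|) / 2.
have th0 : 0 <= th by rewrite divr_ge0// addr_ge0.
have th1 : `|th| < 1 by rewrite ger0_norm// /th; lra.
have H n : `|qit t n - r| <= th ^+ n.
  elim: n => [|n ih]; first by rewrite /= sub0r normrN expr0 ltW.
  rewrite /= {1}rE (_ : _ - _ = (qit t n + r) / 2 * (qit t n - r)); last by field.
  rewrite normrM exprS ler_pM// normrM (@ger0_norm _ 2^-1)//.
  by rewrite ler_pM2r// (le_trans (ler_normD _ _))// lerD2r qit_le1.
apply/cvgrPdist_lt => e e0.
have := cvg_expr th1; move=> /cvgrPdist_lt /(_ _ e0); apply: filterS => n.
rewrite sub0r normrN ger0_norm ?exprn_ge0// => he.
by rewrite distrC (le_lt_trans (H n)).
Qed.

End sqrt_iteration.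

(** * The Euclidean distance as a multiplier *)

Section euclidean_multipliers.
Context d (T : measurableType d) (R : realType).
Variable m : {sigma_finite_measure set T -> \bar R}.
Variables (Q : set T) (b1 b2 : T -> R[i]).
Hypotheses (mQ : measurable Q) (Qoo : (m Q < +oo)%E).
Hypotheses (hb1 : sq_on m Q b1) (hb2 : sq_on m Q b2)
  (hb12 : sq_on m Q (fun x => b1 x * b2 x)).
Local Notation BD := (BD m Q b1 b2).
Variables (n : nat) (co : T -> nat -> R) (c : nat -> R) (l : R).
Hypotheses (mco : forall k, measurable_fun setT (co ^~ k)) (l0 : 0 < l).
Hypothesis Qco : forall x k, Q x -> (k < n)%N -> c k <= co x k < c k + l.
Implicit Types (rho : T * T -> R) (A : R).

Definition dist (p : T * T) : R :=
  Num.sqrt (\sum_(k < n) (co p.1 k - co p.2 k) ^+ 2).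

(** Rescaled coordinates, which carry Q into the unit cube. *)
Definition nco k x : R := (co x k - c k) / l.

Definition nsq x : R := 1 + \sum_(k < n) nco k x ^+ 2.

(* Inverse stereographic projection. *)
Definition stereo (i : 'I_n.+1) x : R :=
  if unlift ord0 i is Some k then 2 * nco k x / nsq x else (2 - nsq x) / nsq x.

Definition tau (p : T * T) : R := \sum_i stereo i p.1 * stereo i p.2.

Lemma measurable_nco k : measurable_fun setT (nco k).
Proof.
apply: measurable_funM; last exact: measurable_cst.
by apply: measurable_funB => //; exact: measurable_cst.
Qed.

Lemma nco_itv k x : Q x -> (k < n)%N -> 0 <= nco k x < 1.
Proof.
move=> qx kn; have /andP[h1 h2] := Qco qx kn.
by rewrite /nco divr_ge0 ?subr_ge0 ?(ltW l0)//= ltr_pdivrMr// mul1r ltrBlDl.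
Qed.

Lemma nco_le1 k x : Q x -> (k < n)%N -> `|nco k x| <= 1.
Proof. by move=> qx kn; have /andP[h1 h2] := nco_itv qx kn; rewrite ger0_norm// ltW. Qed.

Lemma nsq_ge1 x : 1 <= nsq x.
Proof. by rewrite lerDl sumr_ge0// => k _; exact: sqr_ge0. Qed.

Lemma nsq_gt0 x : 0 < nsq x.
Proof. exact: lt_le_trans (nsq_ge1 x). Qed.

Lemma nsq_le x : Q x -> nsq x <= n.+1%:R.
Proof.
move=> qx; rewrite -natr1 addrC /nsq lerD2l.
apply: (@le_trans _ _ (\sum_(k < n) 1)); last by rewrite sumr_const card_ord.
apply: ler_sum => k _; rewrite -real_normK ?num_real// exprn_ile1//.
exact: nco_le1.
Qed.

Lemma measurable_nsq : measurable_fun setT nsq.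
Proof.
apply: measurable_funD; first exact: measurable_cst.
by apply: measurable_sum => k; apply: measurable_funX; exact: measurable_nco.
Qed.

Lemma measurable_stereo i : measurable_fun setT (stereo i).
Proof.
have mV : measurable_fun setT (fun x => (nsq x)^-1).
  by apply: measurable_inv measurable_nsq _ => x; exact/ltW/nsq_gt0.
rewrite /stereo; case: (unlift _ _) => [k|]; apply: measurable_funM => //.
  by apply: measurable_funM; [exact: measurable_cst|exact: measurable_nco].
by apply: measurable_funB; [exact: measurable_cst|exact: measurable_nsq].
Qed.

(** Half the squared chord between the two projected points, by the distance formula of
    stereographic projection. *)
Lemma tauE p : 1 - tau p =
  2 * (\sum_(k < n) (nco k p.1 - nco k p.2) ^+ 2) / (nsq p.1 * nsq p.2).
Proof.
case: p => x y; rewrite /tau big_ord_recl /= {1 2}/stereo unlift_none.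
have n1 := nsq_gt0 x; have n2 := nsq_gt0 y.
have -> : \sum_(k < n) stereo (lift ord0 k) x * stereo (lift ord0 k) y =
    4 * (\sum_(k < n) nco k x * nco k y) / (nsq x * nsq y).
  rewrite mulr_sumr mulr_suml; apply: eq_bigr => k _.
  by rewrite /stereo liftK; field; rewrite !gt_eqF.
have -> : \sum_(k < n) (nco k x - nco k y) ^+ 2 =
    (nsq x - 1) + (nsq y - 1) - 2 * \sum_(k < n) nco k x * nco k y.
  rewrite /nsq !(addrC 1) !addrK mulr_sumr -big_split -sumrB.
  by apply: eq_bigr => k _; rewrite /=; ring.
set S := \sum_(_ < _) _; field; rewrite !gt_eqF//.
Qed.

Lemma stereo_unit x : \sum_i stereo i x ^+ 2 = 1.
Proof.
have := tauE (x, x); rewrite /= big1 ?mulr0 ?mul0r; last first.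
  by move=> k _; rewrite subrr expr0n.
move=> /eqP; rewrite subr_eq0 => /eqP ->; rewrite /tau.
by apply: eq_bigr => i _; rewrite expr2.
Qed.

(** Cauchy-Schwarz, by expanding the squared norms of the sum and the difference of two unit
    vectors. *)
Lemma tau_le1 p : `|tau p| <= 1.
Proof.
have h : 0 <= \sum_i (stereo i p.1 + stereo i p.2) ^+ 2.
  by apply: sumr_ge0 => i _; exact: sqr_ge0.
have h' : 0 <= \sum_i (stereo i p.1 - stereo i p.2) ^+ 2.
  by apply: sumr_ge0 => i _; exact: sqr_ge0.
have e1 : \sum_i (stereo i p.1 + stereo i p.2) ^+ 2 = 2 + 2 * tau p.
  rewrite -[2 in RHS]/(1 + 1) -{1}(stereo_unit p.1) -{1}(stereo_unit p.2).
  rewrite /tau mulr_sumr -!big_split/=.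
  by apply: eq_bigr => i _; ring.
have e2 : \sum_i (stereo i p.1 - stereo i p.2) ^+ 2 = 2 - 2 * tau p.
  rewrite -[2 in RHS]/(1 + 1) -{1}(stereo_unit p.1) -{1}(stereo_unit p.2).
  rewrite /tau mulr_sumr -!big_split/= -sumrB.
  by apply: eq_bigr => i _; ring.
by rewrite ler_norml; apply/andP; split; lra.
Qed.

Lemma dist_ge0 p : 0 <= dist p.
Proof. exact: sqrtr_ge0. Qed.

(** The chord formula solved for the distance: sqrt(1 - tau) is the only factor that mixes the
    variables. *)
Lemma distE p : dist p = l * Num.sqrt (nsq p.1) * Num.sqrt (nsq p.2) *
  (Num.sqrt 2)^-1 * Num.sqrt (1 - tau p).
Proof.
have n1 := nsq_gt0 p.1; have n2 := nsq_gt0 p.2.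
have S0 : 0 <= \sum_(k < n) (nco k p.1 - nco k p.2) ^+ 2.
  by apply: sumr_ge0 => k _; exact: sqr_ge0.
apply/eqP; rewrite -(@eqrXn2 _ 2)// ?dist_ge0//; last first.
  by rewrite !mulr_ge0 ?sqrtr_ge0// ?invr_ge0 ?sqrtr_ge0// ltW.
rewrite !exprMn exprVn !sqr_sqrtr// ?(ltW n1) ?(ltW n2)//; last 2 first.
- by rewrite tauE divr_ge0 ?mulr_ge0// ltW.
- by apply: sumr_ge0 => k _; exact: sqr_ge0.
have -> : \sum_(k < n) (co p.1 k - co p.2 k) ^+ 2 =
    l ^+ 2 * \sum_(k < n) (nco k p.1 - nco k p.2) ^+ 2.
  rewrite mulr_sumr; apply: eq_bigr => k _; rewrite /nco -exprMn.
  by congr (_ ^+ 2); field; rewrite gt_eqF.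
by rewrite tauE; apply/eqP; field; rewrite !gt_eqF.
Qed.

Lemma tau_lt1 p : dist p != 0 -> tau p < 1.
Proof.
move=> dp; rewrite ltNge; apply: contra dp => t1; rewrite distE.
by rewrite (_ : Num.sqrt (1 - tau p) = 0) ?mulr0//; apply/eqP; rewrite sqrtr_eq0 subr_le0.
Qed.

Lemma measurable_dist : measurable_fun setT dist.
Proof.
apply: measurable_sqrt; apply: measurable_sum => k; apply: measurable_funX.
by apply: measurable_funB; [exact: (measurable_fun_p1 (mco k))|exact: (measurable_fun_p2 (mco k))].
Qed.

Lemma measurable_tau : measurable_fun setT tau.
Proof.
apply: measurable_sum => i; apply: measurable_funM.
  exact: (measurable_fun_p1 (measurable_stereo i)).
exact: (measurable_fun_p2 (measurable_stereo i)).
Qed.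

Lemma BDN rho A : BD rho A -> BD (fun p => - rho p) A.
Proof.
move=> h; have := @BD_mul _ _ _ m Q b1 b2 mQ Qoo (fun=> -1) (fun=> 1) rho A
  (measurable_cst _) (measurable_cst _).
move=> /(_ _ _ h); rewrite (_ : (fun p => _) = (fun p => - rho p)).
  by apply => x _; rewrite ?normrN normr1.
by apply/funext => p; rewrite mulr1 mulN1r.
Qed.

(** The induction runs over all [rho] and [A]: q^2 is reached by applying the hypothesis twice, tau
    by [BD_schur] with the unit vectors, and the average of the two keeps the bound A. *)
Lemma BD_qit k rho A : BD rho A -> BD (fun p => qit (tau p) k * rho p) A.
Proof.
elim: k rho A => [|k ih] rho A h.
  have [A0 _ _] := h.
  have := BDZ mQ Qoo hb1 hb2 hb12 (lexx 0) h; rewrite mul0r => h'.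
  exact: BD_le h' A0.
have su x : Q x -> \sum_i stereo i x ^+ 2 <= 1 by rewrite stereo_unit.
have h1 := BD_schur mQ Qoo hb1 hb2 hb12 measurable_stereo su h.
have h2 := ih _ _ (ih _ _ h).
have := BDZ mQ Qoo hb1 hb2 hb12 _ (BDD mQ Qoo hb1 hb2 hb12 h1 h2).
move=> /(_ 2^-1); rewrite (_ : 2^-1 * (A + A) = A); last by field.
rewrite (_ : (fun p => _) = (fun p => qit (tau p) k.+1 * rho p)); first by apply.
by apply/funext => p; rewrite /= /tau; ring.
Qed.

(** The multipliers 1 - q_k have norm factor 2 and converge to sqrt(1 - tau) off the diagonal; the
    diagonal, where [qit_cvg] does not apply, is covered by the vanishing of [rho]. *)
Lemma BD_dist rho A : (forall p, dist p = 0 -> rho p = 0) -> BD rho A ->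
  BD (fun p => dist p * rho p) (2 * l * n.+1%:R * A).
Proof.
move=> rho0 h; have [A0 [mrho [M rhoM]] _] := h.
have h1 k : BD (fun p => (1 - qit (tau p) k) * rho p) (2 * A).
  have := BDD mQ Qoo hb1 hb2 hb12 h (BDN (BD_qit k h)).
  rewrite (_ : A + A = 2 * A); last by ring.
  rewrite (_ : (fun p => _) = (fun p => (1 - qit (tau p) k) * rho p))//.
  by apply/funext => p; ring.
have h2 : BD (fun p => Num.sqrt (1 - tau p) * rho p) (2 * A).
  apply: (BD_lim mQ Qoo hb1 hb2 hb12 h1 (M := 2 * M)).
  - move=> k p q1 q2; rewrite normrM ler_pM// ?rhoM//.
    by rewrite (le_trans (ler_normB _ _))// normr1 -[2]/(1 + 1) lerD2l qit_le1// tau_le1.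
  - split.
      apply: measurable_funM => //; apply: measurable_sqrt.
      by apply: measurable_funB; [exact: measurable_cst|exact: measurable_tau].
    exists (2 * M) => p q1 q2; rewrite normrM ler_pM// ?rhoM//.
    rewrite ger0_norm ?sqrtr_ge0// -(@ler_pXn2r _ 2)// ?nnegrE ?sqrtr_ge0//.
    have := tau_le1 p; rewrite ler_norml => /andP[t1 t2].
    by rewrite sqr_sqrtr ?subr_ge0//; nra.
  - apply: aeW => p q1 q2; have [d0|dn0] := eqVneq (dist p) 0.
      by rewrite rho0// mulr0; under eq_fun do rewrite mulr0; exact: cvg_cst.
    apply: cvgM; last exact: cvg_cst.
    have := qit_cvg (tau_le1 p) (tau_lt1 dn0) => cv.
    rewrite (_ : Num.sqrt (1 - tau p) = 1 - (1 - Num.sqrt (1 - tau p))); last by ring.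
    by apply: cvgB => //; exact: cvg_cst.
(* As 1 + |x|^2 <= n + 1 on Q, these normalised roots are at most 1; the factor n + 1 from both
   variables goes into the constant. *)
pose a x := Num.sqrt (nsq x) / Num.sqrt n.+1%:R.
have n0 : 0 < Num.sqrt n.+1%:R :> R by rewrite sqrtr_gt0.
have ma : measurable_fun setT a.
  apply: measurable_funM; last exact: measurable_cst.
  exact/measurable_sqrt/measurable_nsq.
have a1 x : Q x -> `|a x| <= 1.
  move=> qx; rewrite ger0_norm ?divr_ge0 ?sqrtr_ge0//.
  by rewrite ler_pdivrMr// mul1r ler_sqrt// nsq_le.
have h3 := BD_mul mQ Qoo ma ma a1 a1 h2.
have s2 : 0 < Num.sqrt 2 :> R by rewrite sqrtr_gt0.
have k0 : 0 <= l * n.+1%:R / Num.sqrt 2 by rewrite !mulr_ge0 ?invr_ge0 ?sqrtr_ge0// ltW.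
have := BDZ mQ Qoo hb1 hb2 hb12 k0 h3.
rewrite (_ : (fun p => _) = (fun p => dist p * rho p)); last first.
  apply/funext => p; rewrite distE /a.
  have e : n.+1%:R = Num.sqrt n.+1%:R ^+ 2 :> R by rewrite sqr_sqrtr.
  by rewrite {1}e; field; rewrite !gt_eqF.
move=> h4; apply: (BD_le h4).
rewrite [leRHS](_ : _ = l * n.+1%:R * (2 * A)); last by ring.
rewrite ler_wpM2r ?mulr_ge0// ler_pdivrMr// ler_peMr ?mulr_ge0 ?(ltW l0)//.
by rewrite -[leLHS]sqrtr1 ler_sqrt// ler1n.
Qed.

(** After rescaling, this is l times a difference of a function of x and a function of y, each
    bounded by 1 on Q. *)
Lemma BD_coord_diff k rho A : (k < n)%N -> BD rho A ->
  BD (fun p => (co p.1 k - co p.2 k) * rho p) (2 * l * A).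
Proof.
move=> kn h; have mn := measurable_nco k.
have n1 x : Q x -> `|nco k x| <= 1 by move=> qx; exact: nco_le1.
have o1 x : Q x -> `|1 : R| <= 1 by rewrite normr1.
have h1 := BD_mul mQ Qoo (measurable_cst (1 : R)) mn o1 n1 h.
have h2 := BDN (BD_mul mQ Qoo mn (measurable_cst (1 : R)) n1 o1 h).
have := BDZ mQ Qoo hb1 hb2 hb12 (ltW l0) (BDD mQ Qoo hb1 hb2 hb12 h1 h2).
rewrite (_ : l * (A + A) = 2 * l * A); last by ring.
rewrite (_ : (fun p => _) = (fun p => (co p.1 k - co p.2 k) * rho p))//.
by apply/funext => p; rewrite /nco /cst; field; rewrite gt_eqF.
Qed.

Lemma BD_dist_iter j rho A : (forall p, dist p = 0 -> rho p = 0) -> BD rho A ->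
  BD (fun p => dist p ^+ j * rho p) ((2 * l * n.+1%:R) ^+ j * A).
Proof.
move=> rho0 h; elim: j => [|j ih].
  by rewrite expr0 mul1r; under eq_fun do rewrite expr0 mul1r.
rewrite exprS -mulrA; under eq_fun do rewrite exprS -mulrA.
by apply: BD_dist => // p /rho0 ->; rewrite mulr0.
Qed.

(** The Riesz kernel; division by zero makes it 0 where [dist] vanishes. *)
Definition rkernel (j : nat) (p : T * T) : R :=
  (co p.1 j - co p.2 j) / dist p ^+ n.+1.

(* [\sum_j (x_j - y_j) K_j(x - y) = |x - y|^(1 - n)] *)
Lemma BD_riesz rho A : (0 < n)%N -> measurable_fun setT rho ->
  (forall p, dist p = 0 -> rho p = 0) ->
  (forall j : 'I_n, BD (fun p => rkernel j p * rho p) A) ->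
  BD rho ((2 * l * n.+1%:R) ^+ n.-1 * (n%:R * (2 * l * A))).
Proof.
move=> n0 mrho rho0 h.
have h1 (j : 'I_n) := BD_coord_diff (ltn_ord j) (h j).
have := BD_sum mQ Qoo hb1 hb2 hb12 (index_enum 'I_n) h1.
have -> : \sum_(i <- index_enum 'I_n) (2 * l * A) = n%:R * (2 * l * A).
  by rewrite [RHS]mulr_natl sumr_const card_ord.
move=> h2.
have {}h2 := BD_dist_iter n.-1 _ h2.
apply: (BD_eq (h2 _)) => [p d0|p q1 q2|//].
  by rewrite big1// => i _; rewrite rho0// !mulr0.
have [d0|dn0] := eqVneq (dist p) 0.
  by rewrite rho0// big1 ?mulr0// => i _; rewrite !mulr0.
have dn1 : dist p ^+ n.+1 != 0 by rewrite expf_neq0.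
rewrite (_ : \sum_(_ <- _) _ = dist p ^+ 2 / dist p ^+ n.+1 * rho p); last first.
  rewrite sqr_sqrtr; last by apply: sumr_ge0 => k _; exact: sqr_ge0.
  rewrite mulr_suml mulr_suml; apply: eq_bigr => k _.
  by rewrite /rkernel !mulrA -expr2.
rewrite mulrA; suff -> : dist p ^+ n.-1 * (dist p ^+ 2 / dist p ^+ n.+1) = 1.
  by rewrite mul1r.
by rewrite mulrA -exprD addn2 prednK// divff.
Qed.

End euclidean_multipliers.

(** With independent fair coins, coin i shows heads and coin j tails with probability 1/4 if i and j
    differ; the factor 4 normalises this to 1. *)
Lemma coin_flips (R : realType) (N : nat) (i j : 'I_N) :
  \sum_(s : {ffun 'I_N -> bool}) (4 / 2 ^+ N * (s i && ~~ s j)%:R) = (i != j)%:R :> R.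
Proof.
have [->|ij] := eqVneq i j.
  by rewrite big1// => s _; rewrite andbN mulr0.
(* Independence: the weight splits over the coins, 4 as 2 at i and 2 at j, and 2^-N as 1/2
   everywhere, so that each factor sums to 1. *)
pose F (k : 'I_N) (b : bool) : R :=
  (if k == i then 2 * b%:R else if k == j then 2 * (~~ b)%:R else 1) / 2.
transitivity (\sum_(s : {ffun 'I_N -> bool}) \prod_k F k (s k)).
  apply: eq_bigr => s _; rewrite /F big_split/= prodr_const card_ord exprVn.
  rewrite (bigD1 i)//= (bigD1 j)/=; last by rewrite eq_sym.
  rewrite big1 => [|k /andP[ki kj]]; last by rewrite (negbTE ki) (negbTE kj).
  rewrite !eqxx eq_sym (negbTE ij) mulr1.
  by case: (s i) (s j) => [] []; rewrite /= ?mulr0 ?mul0r ?mulr1//; field; rewrite expf_neq0.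
rewrite -bigA_distr_bigA big1// => k _; rewrite big_bool /F /=.
by case: ifP => _; [|case: ifP => _]; field.
Qed.

(** * Removing the separation *)

Section cells.
Context d (T : measurableType d) (R : realType).
Variable m : {sigma_finite_measure set T -> \bar R}.
Variables (Q : set T) (b1 b2 : T -> R[i]).
Hypotheses (mQ : measurable Q) (Qoo : (m Q < +oo)%E).
Hypotheses (hb1 : sq_on m Q b1) (hb2 : sq_on m Q b2)
  (hb12 : sq_on m Q (fun x => b1 x * b2 x)).
Local Notation BD := (BD m Q b1 b2).
Variable (t : T -> R) (A : R).
Hypotheses (mt : measurable_fun setT t) (Qt : forall x, Q x -> 0 <= t x < 1).
Hypothesis diag0 : (m \x m)%E [set p | t p.1 = t p.2] = 0%E.
(** The constant [A] is the same for every gap [e], which lets the gap shrink to zero. *)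
Hypothesis sep : forall (E E' : set R) (e : R), 0 < e -> measurable E ->
  measurable E' -> (forall s s', E s -> E' s' -> e <= `|s - s'|) ->
  BD (fun p => \1_E (t p.1) * \1_E' (t p.2)) A.

(** The cells coloured by [P], shortened on the right by [e] so that opposite colours stay [e]
    apart; [e = 0] gives the full cells. *)
Definition cells (N : nat) (P : nat -> bool) (e : R) : set R :=
  \bigcup_(k in [set k | P k]) [set` `[k%:R / N%:R, k.+1%:R / N%:R - e[ ].

Lemma measurable_cells N P e : measurable (cells N P e).
Proof. by apply: bigcup_measurable => k _; exact: measurable_itv. Qed.

Lemma cells_sep N P e s s' : 0 < e -> cells N P e s ->
  cells N (fun k => ~~ P k) e s' -> e <= `|s - s'|.
Proof.
move=> e0 [k /= Pk]; rewrite in_itv/= => /andP[k1 k2] [k' /= Pk'].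
rewrite in_itv/= => /andP[k1' k2'].
have mono (a b : nat) : (a <= b)%N -> a%:R / N%:R <= b%:R / N%:R :> R.
  by move=> ab; rewrite ler_wpM2r ?invr_ge0// ler_nat.
have [kk|kk|kk] := ltngtP k k'.
- rewrite distrC (le_trans _ (ler_norm _))//.
  have := mono _ _ kk; lra.
- rewrite (le_trans _ (ler_norm _))//.
  have := mono _ _ kk; lra.
- by move: Pk'; rewrite -kk Pk.
Qed.

(** Shortened or not, only the cell with index truncn(N s) can contain s. *)
Lemma cellsE N P s e : (0 < N)%N -> 0 <= s -> 0 <= e ->
  cells N P e s <-> P (Num.truncn (N%:R * s)) /\
    s < (Num.truncn (N%:R * s)).+1%:R / N%:R - e.
Proof.
move=> N0 s0 e0; have N0' : 0 < N%:R :> R by rewrite ltr0n.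
split=> [[k /= Pk]|[PN sN]].
  rewrite in_itv/= => /andP[k1 k2].
  suff -> : Num.truncn (N%:R * s) = k by [].
  apply: truncn_def; rewrite mulrC -ler_pdivrMr// k1/= -ltr_pdivlMr//; lra.
exists (Num.truncn (N%:R * s)) => //=; rewrite in_itv/= sN andbT.
by rewrite ler_pdivrMr// (mulrC s); have /andP[] := truncn_itv (mulr_ge0 (ltW N0') s0).
Qed.

Lemma cells0E N P s : (0 < N)%N -> 0 <= s ->
  \1_(cells N P 0) s = (P (Num.truncn (N%:R * s)))%:R :> R.
Proof.
move=> N0 s0; rewrite indicE; congr (_ %:R).
have N0' : 0 < N%:R :> R by rewrite ltr0n.
have := cellsE P N0 s0 (lexx 0) => h; congr nat_of_bool; apply/idP/idP.
  by rewrite inE => /h[].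
move=> hP; rewrite inE; apply/h; split=> //.
by rewrite subr0 ltr_pdivlMr// mulrC; have /andP[] := truncn_itv (mulr_ge0 (ltW N0') s0).
Qed.

(** Cells are half-open, so s lies strictly below the right end of its cell, and small shortenings
    do not affect it. *)
Lemma cells_cvg N P s : (0 < N)%N -> 0 <= s ->
  (fun k => \1_(cells N P k.+1%:R^-1) s : R) @ \oo --> (\1_(cells N P 0) s : R).
Proof.
move=> N0 s0; apply: cvg_near_cst.
have N0' : 0 < N%:R :> R by rewrite ltr0n.
set K := Num.truncn (N%:R * s).
have sK : 0 < K.+1%:R / N%:R - s.
  rewrite subr_gt0 ltr_pdivlMr// mulrC.
  by have /andP[] := truncn_itv (mulr_ge0 (ltW N0') s0).
have := @cvg_harmonic R; move=> /cvgrPdist_lt/(_ _ sK); apply: filterS => k.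
rewrite sub0r normrN /harmonic/= ger0_norm ?invr_ge0// => hk.
rewrite !indicE; congr (_ %:R); congr nat_of_bool; apply/idP/idP; rewrite !inE.
  move=> /(cellsE _ N0 s0 _).1 [|]; first by [].
  move=> PK _; apply/(cellsE _ N0 s0 _) => //; split => //.
  by rewrite -/K; lra.
move=> /(cellsE _ N0 s0 (lexx _)).1 [PK _].
by apply/(cellsE _ N0 s0 _) => //; split => //; rewrite -/K ltrBrDl -ltrBrDr.
Qed.

Lemma indic_le1 (E : set R) (s : R) : `|\1_E s : R| <= 1.
Proof. by rewrite indicE; case: (_ \in _); rewrite ?normr1 ?normr0. Qed.

Lemma measurable_indic_t (E : set R) : measurable E ->
  measurable_fun setT (fun x => \1_E (t x) : R).
Proof. by move=> mE; apply: measurableT_comp mt; exact: measurable_indic. Qed.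

Lemma multbd_indic (E E' : set R) : measurable E -> measurable E' ->
  multbd Q (fun p => \1_E (t p.1) * \1_E' (t p.2) : R).
Proof.
move=> mE mE'; split.
  apply: measurable_funM.
    exact: (measurable_fun_p1 (measurable_indic_t mE)).
  exact: (measurable_fun_p2 (measurable_indic_t mE')).
by exists 1 => p _ _; rewrite normrM mulr_ile1 ?indic_le1.
Qed.

Lemma BD_cells N P : (0 < N)%N ->
  BD (fun p => \1_(cells N P 0) (t p.1) * \1_(cells N (fun k => ~~ P k) 0) (t p.2)) A.
Proof.
move=> N0; pose e k : R := k.+1%:R^-1.
apply: (BD_lim mQ Qoo hb1 hb2 hb12 (M := 1) (rho_ := fun k p =>
  \1_(cells N P (e k)) (t p.1) * \1_(cells N (fun k => ~~ P k) (e k)) (t p.2))).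
- move=> k; apply: (sep (e := e k)); rewrite ?invr_gt0//; try exact: measurable_cells.
  by move=> s s'; apply: cells_sep; rewrite invr_gt0.
- by move=> k p _ _; rewrite normrM mulr_ile1 ?indic_le1.
- by apply: multbd_indic; exact: measurable_cells.
- apply: aeW => p q1 q2; have /andP[t1 _] := Qt q1; have /andP[t2 _] := Qt q2.
  by apply: cvgM; exact: cells_cvg.
Qed.

(* Averaging over all colourings of the cells by fair coins, a pair of points in
   distinct cells is separated by the colouring with probability 1/4. *)
Definition bits N (s : {ffun 'I_N -> bool}) (k : nat) : bool :=
  if insub k is Some i then s i else false.

Lemma BD_distinct_cells N : (0 < N)%N -> exists rho, BD rho (4 * A) /\
  forall p, Q p.1 -> Q p.2 ->
    rho p = (Num.truncn (N%:R * t p.1) != Num.truncn (N%:R * t p.2))%:R.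
Proof.
move=> N0; pose a : R := 4 / 2 ^+ N.
have a0 : 0 <= a by rewrite divr_ge0// exprn_ge0.
have h (s : {ffun 'I_N -> bool}) := BDZ mQ Qoo hb1 hb2 hb12 a0 (BD_cells (bits s) N0).
have := BD_sum mQ Qoo hb1 hb2 hb12 (index_enum {ffun 'I_N -> bool}) h.
set rho := (fun p => _); move=> hr; exists rho; split.
  (* The 2^N colourings of weight 4 / 2^N have total weight 4. *)
  rewrite (_ : 4 * A = \sum_(s : {ffun 'I_N -> bool}) a * A)//.
  rewrite sumr_const card_ffun card_bool card_ord -[RHS]mulr_natl natrX /a.
  by field; rewrite expf_neq0.
move=> p q1 q2; rewrite /rho; have /andP[t1 t1'] := Qt q1; have /andP[t2 t2'] := Qt q2.
under eq_bigr do rewrite !cells0E//.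
have N0' : 0 < N%:R :> R by rewrite ltr0n.
(* As t < 1 on Q, the cell index is below N, where [bits] reads a coin and not its default. *)
have lt (x : R) : 0 <= x -> x < 1 -> (Num.truncn (N%:R * x) < N)%N.
  move=> x0 x1; rewrite -(@ltr_nat R).
  have /andP[h1 _] := truncn_itv (mulr_ge0 (ltW N0') x0).
  by rewrite (le_lt_trans h1)// gtr_pMr.
have e x (hx : (x < N)%N) (s : {ffun 'I_N -> bool}) : bits s x = s (Ordinal hx).
  by rewrite /bits insubT.
transitivity ((Ordinal (lt _ t1 t1') != Ordinal (lt _ t2 t2'))%:R : R).
  rewrite -coin_flips; apply: eq_bigr => s _.
  by rewrite -!e -mulnb natrM.
by congr (_ %:R).
Qed.

Lemma truncn_neq (x y : R) : 0 <= x -> 0 <= y -> 1 <= `|x - y| ->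
  Num.truncn x != Num.truncn y.
Proof.
move=> x0 y0; apply: contraTneq => e; rewrite -ltNge.
have := truncn_itv x0; have := truncn_itv y0; rewrite e -natr1.
move=> /andP[h1 h2] /andP[h3 h4]; rewrite ltr_norml; apply/andP; split; lra.
Qed.

(** Points with different slab coordinates fall into different cells once the mesh is small; the
    remaining pairs form a null set by [diag0]. *)
Lemma BD_one : BD (fun=> 1) (4 * A).
Proof.
have h N : exists rho, BD rho (4 * A) /\ forall p, Q p.1 -> Q p.2 ->
    rho p = (Num.truncn (N.+1%:R * t p.1) != Num.truncn (N.+1%:R * t p.2))%:R.
  exact: BD_distinct_cells.
have [rho_ hrho] := choice h.
apply: (BD_lim mQ Qoo hb1 hb2 hb12 (M := 1) (rho_ := rho_)).
- by move=> N; have [] := hrho N.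
- move=> N p q1 q2; have [_ ->//] := hrho N.
  by case: (_ != _); rewrite ?normr1 ?normr0.
- by split; [exact: measurable_cst|exists 1 => p _ _; rewrite normr1].
- exists [set p | t p.1 = t p.2]; split => //.
    rewrite (_ : mkset _ = (fun p => t p.1 - t p.2) @^-1` [set 0]).
      rewrite -[X in measurable X]setTI; apply: measurable_funB => //.
      + exact: (measurable_fun_p1 mt).
      + exact: (measurable_fun_p2 mt).
    apply/funext => p /=; apply/propext; split=> [->|/eqP]; first by rewrite subrr.
    by rewrite subr_eq0 => /eqP.
  move=> p /= np; apply: contrapT => tp; apply: np => q1 q2.
  have /andP[t1 _] := Qt q1; have /andP[t2 _] := Qt q2.
  apply: cvg_near_cst.
  have d0 : 0 < `|t p.1 - t p.2| by rewrite normr_gt0 subr_eq0; apply/eqP.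
  (* From this index on, (N + 1) |t - t'| >= 1, which puts the two points into different cells. *)
  exists (Num.truncn `|t p.1 - t p.2|^-1) => // N /= hN.
  have [_ ->//] := hrho N; rewrite truncn_neq//; try by rewrite mulr_ge0.
  rewrite -mulrBr normrM ger0_norm// -ler_pdivrMr// div1r.
  rewrite ltW// (lt_le_trans (truncnS_gt _))// ler_nat//.
Qed.

End cells.

(** The measure [leb] with its sigma-finiteness kept visible, as products and Fubini demand. *)
Definition lebs (R : realType) (n : nat) :
  {sigma_finite_measure set (Rd R n) -> \bar R} := msp_meas (Rsp R n).

(** * Cubes and Lebesgue measure *)

Section Rd_geometry.
Context (R : realType).

Lemma measurable_coord n k :
  measurable_fun setT (fun x : Rd R n => Defs.coord x k).
Proof.
elim: n k => [|n ih] k /=; first exact: measurable_cst.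
case: k => [|k]; first exact: measurable_fst.
exact: (measurableT_comp (ih k) measurable_snd).
Qed.

Lemma measurable_cube n (c : nat -> R) (l : R) : measurable (cube (d := n) c l).
Proof.
rewrite (_ : cube c l = \bigcap_(k in [set k | (k < n)%N])
    ((fun x : Rd R n => Defs.coord x k) @^-1` [set` `[c k, c k + l[ ])).
  apply: bigcap_measurableType => k _; rewrite -[X in measurable X]setTI.
  by apply: measurable_coord => //; exact: measurable_itv.
by apply/seteqP; split => x /= h k kn; have := h k kn; rewrite /= in_itv.
Qed.

(** Induction on the dimension, splitting off the first coordinate; in dimension 0 the space is a
    point of mass 1. *)
Lemma leb_cube n (c : nat -> R) (l : R) : 0 < l ->
  lebs R n (cube (d := n) c l) = (l ^+ n)%:E.
Proof.
move=> l0; elim: n c => [|n ih] c.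
  rewrite expr0 (_ : cube _ _ = setT); last by apply/seteqP; split.
  by rewrite /= diracT.
rewrite (_ : cube _ _ = ([set` `[c 0%N, c 0%N + l[ ] `*`
    cube (d := n) (fun k => c k.+1) l : set (Rd R n.+1))).
  rewrite /lebs /= /pmeas product_measure1E//; last exact: measurable_cube.
  have e1 : lebesgue_measure [set` `[c 0%N, c 0%N + l[ ] = l%:E.
    by rewrite lebesgue_measure_itv/= lte_fin ltrDl l0 -EFinB addrC addKr.
  by rewrite [X in (_ * X)%E]ih [X in (X * _)%E](_ : _ = l%:E) ?exprS.
apply/seteqP; split=> [[x y]/= h|[x y]/= [h1 h2]].
  split; first by have := h 0%N isT; rewrite /= in_itv.
  by move=> k kn; exact: (h k.+1).
by case=> [|k] kn; [move: h1; rewrite in_itv|exact: h2].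
Qed.

(** For a fixed first point the section is a hyperplane, hence null; zero times the possibly
    infinite measure of the other coordinates is zero. *)
Lemma diag_coord0 n : (0 < n)%N ->
  (lebs R n \x lebs R n)%E [set p | Defs.coord p.1 0 = Defs.coord p.2 0] = 0%E.
Proof.
case: n => // n _; rewrite /product_measure1 /=.
rewrite integral0_eq// => -[x x'] _ /=.
rewrite (_ : xsection _ _ = [set x] `*` setT).
  have mx : measurable ([set x] : set (measurableTypeR R)) by exact: measurable_set1.
  rewrite /pmeas product_measure1E//.
  have e1 : lebesgue_measure [set x] = 0%E by exact: lebesgue_measure_set1.
  by rewrite [X in (X * _)%E](_ : _ = 0%E) ?mul0e.
apply/seteqP; split => -[y y'] /=; rewrite /xsection/= inE/=.
  by move=> ->.
by move=> [->].
Qed.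

End Rd_geometry.

(** * The Riesz commutator off the support *)

Section separated.
Context (R : realType) (d : nat).
Local Notation m := (lebs R d).
Local Notation mm := (m \x m)%E.
Local Notation coord := (@Defs.coord R d).
Local Notation dist := (dist d coord).
Local Notation K := (rkernel d coord).
Variables (c : nat -> R) (l : R) (b1 b2 : Rd R d -> R[i]) (j : nat).
Hypotheses (l0 : 0 < l) (jd : (j < d)%N).
Local Notation Q := (cube (d := d) c l).
Hypotheses (hb1 : sq_on m Q b1) (hb2 : sq_on m Q b2)
  (hb12 : sq_on m Q (fun x => b1 x * b2 x)).
Local Notation hform := (hform b1 b2).
Local Notation test := (test Q).

Let mQ : measurable Q. Proof. exact: measurable_cube. Qed.
Let Qoo : (m Q < +oo)%E. Proof. by rewrite leb_cube// ltry. Qed.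

Definition ker_trunc (e : R) (p : Rd R d * Rd R d) : R :=
  \1_[set p | e <= dist p] p * K j p.

Lemma measurable_rkernel : measurable_fun setT (K j).
Proof.
apply: measurable_funM.
  apply: measurable_funB; first exact: (measurable_fun_p1 (measurable_coord _)).
  exact: (measurable_fun_p2 (measurable_coord _)).
apply: measurable_inv; last by move=> p; rewrite exprn_ge0// dist_ge0.
by apply: measurable_funX; apply: measurable_dist => k; exact: measurable_coord.
Qed.

Lemma coord_le_dist p : `|coord p.1 j - coord p.2 j| <= dist p.
Proof.
rewrite -(@ler_pXn2r _ 2)// ?nnegrE ?dist_ge0// real_normK ?num_real//.
rewrite sqr_sqrtr; last by apply: sumr_ge0 => k _; exact: sqr_ge0.
rewrite (bigD1 (Ordinal jd))//= lerDl.
by apply: sumr_ge0 => k _; exact: sqr_ge0.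
Qed.

(** As |x_j - y_j| <= |x - y|, the kernel is at most |x - y|^(-d). *)
Lemma ker_trunc_bound e p : 0 < e -> `|ker_trunc e p| <= e^-1 ^+ d.
Proof.
move=> e0; rewrite /ker_trunc indicE; have [|_] := boolP (p \in _); last first.
  by rewrite mul0r normr0 exprn_ge0// invr_ge0 ltW.
rewrite inE/= mul1r /rkernel => ed; have d0 := lt_le_trans e0 ed.
rewrite normrM normfV (ger0_norm (exprn_ge0 _ (ltW d0))).
rewrite ler_pdivrMr ?exprn_gt0// (le_trans (coord_le_dist p))//.
rewrite exprS mulrCA ler_peMr ?(ltW d0)// -exprMn exprn_ege1// mulrC.
by rewrite ler_pdivlMr// mul1r.
Qed.

Lemma measurable_ker_trunc e : measurable_fun setT (ker_trunc e).
Proof.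
apply: measurable_funM; last exact: measurable_rkernel.
apply: measurable_indic.
rewrite (_ : mkset _ = dist @^-1` [set` `[e, +oo[]).
  rewrite -[X in measurable X]setTI.
  have md : measurable_fun setT dist.
    by apply: measurable_dist => k; exact: measurable_coord.
  by apply: md => //; exact: measurable_itv.
by apply/seteqP; split => p /=; rewrite in_itv/= andbT.
Qed.

Lemma measurable_ker_trunc_x e x : measurable_fun setT (fun y => ker_trunc e (x, y)).
Proof. exact: (measurableT_comp (measurable_ker_trunc e) (pair1_measurable x)). Qed.

(** For eps < e the truncation removes nothing from the support, so the truncated integrals no
    longer depend on eps. Here [h] will be [f] times products of the symbols. *)
Lemma riesz_off_support (f h : Rd R d -> R[i]) e x : 0 < e ->
  (forall y, f y = 0 -> h y = 0) -> (forall y, f y != 0 -> e <= dist (x, y)) ->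
  riesz j h x = Cint m (fun y => (ker_trunc e (x, y))%:C%C * h y).
Proof.
move=> e0 fh sep.
have key (eps : R) (P : R[i] -> R) : P 0 = 0 -> eps < e ->
    Rintegral (leb R d) [set y | eps < Defs.edist x y] (fun y => P
      (((coord x j - coord y j) / Defs.edist x y ^+ d.+1)%:C%C * h y)) =
    \int[m]_y P ((ker_trunc e (x, y))%:C%C * h y).
  move=> P0 epse; rewrite Rintegral_mkcond; apply: eq_Rintegral => y _.
  rewrite patchE; have [f0|fn0] := eqVneq (f y) 0.
    by rewrite fh// !mulr0 P0; case: ifP.
  have ed := sep y fn0.
  rewrite mem_set/=; last exact: lt_le_trans epse ed.
  by rewrite /ker_trunc indicE mem_set//= mul1r.
apply: complex_eq => /=.
  apply: cvg_lim => //; apply: cvg_near_cst; near=> eps.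
  have epse : eps < e by near: eps; exact: nbhs_right_lt.
  exact: (key eps (@complex.Re R) erefl epse).
apply: cvg_lim => //; apply: cvg_near_cst; near=> eps.
have epse : eps < e by near: eps; exact: nbhs_right_lt.
  exact: (key eps (@complex.Im R) erefl epse).
Unshelve. all: by end_near. Qed.

Lemma cintegrable_ker e x u : 0 < e -> cintegrable m u ->
  cintegrable m (fun y => (ker_trunc e (x, y))%:C%C * u y).
Proof.
move=> e0 [ru iu].
have H (v : Rd R d -> R) : rintegrable m v ->
    rintegrable m (fun y => ker_trunc e (x, y) * v y).
  move=> iv; apply: (@rintegrable_le _ _ _ _ _ (fun y => e^-1 ^+ d * `|v y|)).
  - by apply: measurable_funM; [exact: measurable_ker_trunc_x|exact: rintegrable_meas iv].
  - by move=> y; rewrite normrM ler_wpM2r// ker_trunc_bound.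
  - exact/rintegrableZ/rintegrable_abs.
split.
  by under eq_fun do rewrite ReM/= mul0r subr0; exact: H.
by under eq_fun do rewrite ImM/= mul0r addr0; exact: H.
Qed.

(** The double commutator unfolds into Riesz transforms of f, b1 f, b2 f and b1 b2 f. Away from the
    support each is an absolutely convergent integral, and together they rebuild k. *)
Lemma commutator_off_support f e x : 0 < e -> test f ->
  (forall y, f y != 0 -> e <= dist (x, y)) ->
  CbT b1 b2 (riesz j) f x =
  Cint m (fun y => (ker_trunc e (x, y))%:C%C *
    ((b1 x - b1 y) * (b2 x - b2 y) * f y)).
Proof.
move=> e0 tf sep; have [g1 g2 g3 g4] := test_good mQ Qoo hb1 hb2 hb12 tf.
rewrite /CbT /commut /mult.
rewrite (riesz_off_support e0 _ sep)// (riesz_off_support e0 _ sep); last first.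
  by move=> y ->; rewrite mulr0.
rewrite (riesz_off_support e0 _ sep); last by move=> y ->; rewrite mulr0.
rewrite (riesz_off_support e0 _ sep); last by move=> y ->; rewrite !mulr0.
have c1 := cintegrable_ker x e0 g1; have c2 := cintegrable_ker x e0 g2.
have c3 := cintegrable_ker x e0 g3; have c4 := cintegrable_ker x e0 g4.
have c12 := cintegrableB (cintegrableZ (b1 x) c1) c2.
have c34 := cintegrableB (cintegrableZ (b1 x) c3) c4.
transitivity (Cint m (fun y => b2 x *
    (b1 x * ((ker_trunc e (x, y))%:C%C * f y) - (ker_trunc e (x, y))%:C%C * (b1 y * f y))
  - (b1 x * ((ker_trunc e (x, y))%:C%C * (b2 y * f y))
     - (ker_trunc e (x, y))%:C%C * (b1 y * b2 y * f y)))); last first.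
  by congr (Cint m _); apply/funext => y; ring.
rewrite (CintB (cintegrableZ (b2 x) c12) c34) (CintZ _ c12).
rewrite (CintB (cintegrableZ (b1 x) c1) c2) (CintB (cintegrableZ (b1 x) c3) c4).
rewrite (CintZ _ c1) (CintZ _ c3); congr (_ - (_ - _)).
by congr (Cint m _); apply/funext => y; rewrite !mulrA.
Qed.

Lemma L2norm_sqint f : rintegrable m (fun x => sqn (f x)) ->
  L2norm f = ((Num.sqrt (sqint m f))%:E)%E.
Proof.
move=> isq; rewrite /L2norm unlock.
rewrite (_ : (\int[leb R d]_x _)%E = (sqint m f)%:E).
  by rewrite poweR_EFin powR12_sqrt// sqint_ge0.
rewrite /sqint EFin_Rintegral//; apply: eq_integral => x _.
by rewrite abse_EFin poweR_EFin ger0_norm ?cabs_ge0// powR_mulrn ?cabs_ge0// cabs_sqr.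
Qed.

Lemma L2norm_le_integral (F : Rd R d -> R[i]) (N : R) : 0 <= N ->
  (L2norm F <= N%:E)%E -> (\int[m]_x (sqn (F x))%:E <= (N ^+ 2)%:E)%E.
Proof.
move=> N0; rewrite /L2norm => h.
have -> : (\int[m]_x (sqn (F x))%:E)%E =
    (\int[m]_x `| (cabs (F x))%:E | `^ 2)%E.
  apply: eq_integral => x _.
  by rewrite abse_EFin poweR_EFin ger0_norm ?cabs_ge0// powR_mulrn ?cabs_ge0// cabs_sqr.
have := @poweR_Lnorm _ _ _ (leb R d) (fun x => (cabs (F x))%:E) 2.
rewrite pnatr_eq0 => /(_ isT) <-.
rewrite -powR_mulrn// -poweR_EFin gt0_ler_poweR//.
  by rewrite in_itv/= leey Lnorm_ge0.
by rewrite in_itv/= leey andbT lee_fin.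
Qed.

(** Duality: integrating in y first turns the form into the integral of Re(g F), where F is the
    commutator applied to f and has norm at most N. *)
Lemma separated_bound_unit f g e N : 0 < e -> 0 < N -> test f -> test g ->
  (forall x y, f y != 0 -> g x != 0 -> e <= dist (x, y)) ->
  (opnorm2 (CbT b1 b2 (riesz (d := d) j)) <= N%:E)%E -> sqint m f <= 1 ->
  \int[mm]_p (ker_trunc e p * hform f g p) <= N / 2 * (1 + sqint m g).
Proof.
move=> e0 N0 tf tg sep opN f1.
have kb : multbd Q (ker_trunc e).
  split; first exact: measurable_ker_trunc.
  by exists (e^-1 ^+ d) => p _ _; exact: ker_trunc_bound.
have iH := multbd_integrable mQ Qoo hb1 hb2 hb12 kb tf tg.
pose F := CbT b1 b2 (riesz (d := d) j) f.
pose Phi x := \int[m]_y (ker_trunc e (x, y) * hform f g (x, y)).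
rewrite (Rintegral_fubini iH) -/Phi.
(* The formula for F is available only away from the support of f; where g vanishes, both sides are
   0. *)
have PhiE x : Phi x = Re (g x * F x).
  have [g0|gn0] := eqVneq (g x) 0.
    rewrite g0 mul0r /= -(mul0r (fine (m setT))) -Rintegral_cst//.
    by apply: eq_Rintegral => y _; rewrite /hform /= g0 !mulr0.
  rewrite /F (commutator_off_support e0 tf); last by move=> y fy; exact: sep.
  have [g1 g2 g3 g4] := test_good mQ Qoo hb1 hb2 hb12 tf.
  have ci : cintegrable m (fun y => (ker_trunc e (x, y))%:C%C *
      ((b1 x - b1 y) * (b2 x - b2 y) * f y)).
    apply: cintegrable_ker => //.
    rewrite (_ : (fun _ => _) = fun y => (b1 x * b2 x) * f y - b1 x * (b2 y * f y)
      - (b2 x * (b1 y * f y) - b1 y * b2 y * f y)); last first.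
      by apply/funext => y; ring.
    apply: cintegrableB; apply: cintegrableB => //; exact: cintegrableZ.
  rewrite -CintZ//=; apply: eq_Rintegral => y _.
  by rewrite /hform !ReImE/=; ring.
(* [Phi] is the inner Fubini integral passed through [fine], which does not increase the modulus. *)
have iPhi : rintegrable m Phi.
  have h1 := integrable_fubini_F iH; apply: le_integrable h1 => //.
    apply/measurable_EFinP; apply: measurableT_comp => //.
    exact: measurable_int (integrable_fubini_F iH).
  by move=> x _; rewrite /= /Phi /Rintegral /fubini_F/=;
    case: (integral _ _ _) => [r||] //=; rewrite ?normr0 ?leey.
have mPhi := rintegrable_meas iPhi.
have [mg _ _] := tg; have isg := rintegrable_sqn mQ Qoo tg.
(* [G <= |F|^2] is measurable even if [F] is not; it vanishes with [g], as [0^-1 = 0]. *)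
pose G x := Phi x ^+ 2 * (sqn (g x))^-1.
have G0 x : 0 <= G x by rewrite mulr_ge0 ?sqr_ge0// invr_ge0 sqn_ge0.
have mG : measurable_fun setT G.
  apply: measurable_funM; first exact: measurable_funX.
  by apply: measurable_inv => [|x]; [exact: measurable_sqn|exact: sqn_ge0].
have GF x : G x <= sqn (F x).
  rewrite /G; have [s0|sn0] := eqVneq (sqn (g x)) 0; first by rewrite s0 invr0 mulr0 sqn_ge0.
  rewrite ler_pdivrMr; last by rewrite lt_neqAle eq_sym sn0 sqn_ge0.
  by rewrite PhiE mulrC -sqnM /sqn lerDl sqr_ge0.
have FN : (\int[m]_x (sqn (F x))%:E <= (N ^+ 2)%:E)%E.
  apply: L2norm_le_integral; first exact: ltW.
  apply: le_trans opN; apply: ereal_sup_ubound; exists f => //; split.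
    have [mf bf zf] := tf; split => //; split => //; exists Q; split => //.
    by exists c, l.
  rewrite L2norm_sqint; last exact: rintegrable_sqn tf.
  by rewrite lee_fin -[leRHS]sqrtr1 ler_sqrt.
have GN : (\int[m]_x (G x)%:E <= (N ^+ 2)%:E)%E.
  apply: le_trans FN; apply: ge0_le_integral_nonmeas => x.
    by rewrite lee_fin.
  by rewrite lee_fin.
have iG : rintegrable m G.
  by apply: rintegrable_ge0 => //; exact: le_lt_trans GN (ltry _).
have IG : \int[m]_x G x <= N ^+ 2 by rewrite -lee_fin EFin_Rintegral.
(* Young's inequality Phi <= N/2 |g|^2 + G/(2N); the integral of G is at most N^2, so both weights
   become N/2. *)
apply: (@le_trans _ _ (\int[m]_x (N / 2 * sqn (g x) + (2 * N)^-1 * G x))).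
  apply: le_Rint => //; first by apply: rintegrableD; exact: rintegrableZ.
  move=> x; rewrite -/(Phi x); have [s0|sn0] := eqVneq (sqn (g x)) 0.
    have g0 : g x = 0.
      move: s0 => /eqP; rewrite /sqn paddr_eq0 ?sqr_ge0// !sqrf_eq0 => /andP[/eqP p1 /eqP p2].
      exact: complex_eq.
    by rewrite PhiE s0 g0 mul0r mulr0 add0r mulr_ge0// invr_ge0 mulr_ge0// ltW.
  have sp : 0 < sqn (g x) by rewrite lt_neqAle eq_sym sn0 sqn_ge0.
  rewrite -subr_ge0 (_ : _ - _ = (N * sqn (g x) - Phi x) ^+ 2 / (2 * N * sqn (g x))).
    by rewrite divr_ge0 ?sqr_ge0// !mulr_ge0// ltW.
  by rewrite /G; field; rewrite !gt_eqF.
rewrite RintegralD//; [|exact: rintegrableZ..].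
rewrite !RintegralZl// mulrDr mulr1 addrC lerD2r.
rewrite (_ : N / 2 = (2 * N)^-1 * N ^+ 2); last by field; rewrite gt_eqF.
by rewrite ler_wpM2l// invr_ge0 mulr_ge0// ltW.
Qed.

(** Homogeneity: dividing both functions by sqrt(a) reduces to norm at most 1. The number a stays
    above the squared norm of f, which may be 0, and then decreases to it. *)
Lemma separated_bound f g e N : 0 < e -> 0 < N -> test f -> test g ->
  (forall x y, f y != 0 -> g x != 0 -> e <= dist (x, y)) ->
  (opnorm2 (CbT b1 b2 (riesz (d := d) j)) <= N%:E)%E ->
  \int[mm]_p (ker_trunc e p * hform f g p) <= N / 2 * (sqint m f + sqint m g).
Proof.
move=> e0 N0 tf tg sep opN.
have kb : multbd Q (ker_trunc e).
  split; first exact: measurable_ker_trunc.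
  by exists (e^-1 ^+ d) => p _ _; exact: ker_trunc_bound.
have iH := multbd_integrable mQ Qoo hb1 hb2 hb12 kb tf tg.
suff H a : sqint m f < a -> 0 < a ->
    \int[mm]_p (ker_trunc e p * hform f g p) <= N / 2 * (a + sqint m g).
  apply/ler_addgt0Pr => r r0; have f0 := sqint_ge0 m f.
  have N2 : 0 < N / 2 by rewrite divr_gt0.
  (* This choice of a costs exactly r in the bound. *)
  have := H (sqint m f + r / (N / 2)).
  rewrite ltrDl divr_gt0// ltr_wpDl ?divr_gt0// => /(_ isT isT)/le_trans; apply.
  rewrite le_eqVlt; apply/orP; left; apply/eqP; field.
  by rewrite gt_eqF.
move=> fa a0; pose s : R := (Num.sqrt a)^-1.
have s0 : 0 < s by rewrite invr_gt0 sqrtr_gt0.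
have s2 : s ^+ 2 = a^-1 by rewrite exprVn sqr_sqrtr// ltW.
have ms : measurable_fun setT (fun _ : Rd R d => s) by exact: measurable_cst.
have bs (x : Rd R d) : Q x -> `|s| <= s by rewrite ger0_norm// ltW.
have tsf := testM tf ms bs; have tsg := testM tg ms bs.
have sqs u : test u -> sqint m (fun x => (s%:C)%C * u x) = a^-1 * sqint m u.
  move=> tu; rewrite /sqint -RintegralZl//; last exact: rintegrable_sqn tu.
  by apply: eq_Rintegral => x _; rewrite sqn_realM s2.
have := @separated_bound_unit _ _ e N e0 N0 tsf tsg _ opN.
have sep' x y : (s%:C)%C * f y != 0 -> (s%:C)%C * g x != 0 -> e <= dist (x, y).
  by rewrite !mulf_eq0 !negb_or => /andP[_ fy] /andP[_ gx]; exact: sep.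
move=> /(_ sep'); rewrite !sqs// => hs.
have {hs} := hs _; rewrite mulrC ler_pdivrMr// mul1r => /(_ (ltW fa)).
rewrite (_ : Rintegral _ _ _ = a^-1 * \int[mm]_p (ker_trunc e p * hform f g p)).
  rewrite mulrC ler_pdivrMr// => /le_trans; apply.
  rewrite le_eqVlt; apply/orP; left; apply/eqP; field; by rewrite gt_eqF.
rewrite -RintegralZl//; apply: eq_Rintegral => p _; rewrite hformM -s2; ring.
Qed.

Hypothesis d0 : (0 < d)%N.

(** The indicators are absorbed into g and f, whose supports are then at distance at least e l,
    where truncation does not change the kernel. The bound N/2 is independent of e. *)
Lemma BD_separated_kernel (E E' : set R) (e N : R) : 0 < e -> 0 < N ->
  measurable E -> measurable E' ->
  (forall s s', E s -> E' s' -> e <= `|s - s'|) ->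
  (opnorm2 (CbT b1 b2 (riesz (d := d) j)) <= N%:E)%E ->
  BD m Q b1 b2 (fun p => K j p *
    (\1_E (nco coord c l 0 p.1) * \1_E' (nco coord c l 0 p.2))) (N / 2).
Proof.
move=> e0 N0 mE mE' sep opN.
pose t := nco coord c l 0%N.
have mt : measurable_fun setT t.
  by apply: measurable_nco => k; exact: measurable_coord.
have mi (D : set R) : measurable D -> measurable_fun setT (fun x => \1_D (t x) : R).
  by move=> mD; exact: measurable_indic_t.
have i1 (D : set R) x : Q x -> `|\1_D (t x) : R| <= 1 by move=> _; exact: indic_le1.
have dsep p : E (t p.1) -> E' (t p.2) -> e * l <= dist p.
  move=> h1 h2; rewrite -ler_pdivlMr// (le_trans (sep _ _ h1 h2))//.
  rewrite /t /nco -mulrBl opprB addrA subrK normrM normfV (gtr0_norm l0).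
  rewrite ler_pM2r ?invr_gt0//.
  rewrite -(@ler_pXn2r _ 2)// ?nnegrE ?dist_ge0// real_normK ?num_real//.
  rewrite sqr_sqrtr; last by apply: sumr_ge0 => k _; exact: sqr_ge0.
  rewrite (bigD1 (Ordinal d0))//= lerDl.
  by apply: sumr_ge0 => k _; exact: sqr_ge0.
have el0 : 0 < e * l by rewrite mulr_gt0.
have kE p : K j p * (\1_E (t p.1) * \1_E' (t p.2)) =
    ker_trunc (e * l) p * (\1_E (t p.1) * \1_E' (t p.2)).
  rewrite /ker_trunc !indicE.
  have [h1|_] := boolP (t p.1 \in E); last by rewrite !mul0r !mulr0.
  have [h2|_] := boolP (t p.2 \in E'); last by rewrite !mulr0.
  by rewrite mem_set ?mul1r//=; apply: dsep; exact: set_mem.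
split; first by rewrite divr_ge0// ltW.
  split.
    apply: measurable_funM; first exact: measurable_rkernel.
    apply: measurable_funM; first exact: (measurable_fun_p1 (mi _ mE)).
    exact: (measurable_fun_p2 (mi _ mE')).
  exists ((e * l)^-1 ^+ d) => p _ _; rewrite kE normrM.
  rewrite -[leRHS]mulr1 ler_pM ?ker_trunc_bound//.
  by rewrite normrM mulr_ile1 ?indic_le1.
move=> f g tf tg.
have tEf := testM tf (mi _ mE') (i1 E'); have tEg := testM tg (mi _ mE) (i1 E).
have sq_le u D : test u -> measurable D ->
    sqint m (fun x => (\1_D (t x))%:C%C * u x) <= sqint m u.
  move=> tu mD; apply: (sqint_le mQ Qoo) => //; first exact: (testM tu (mi _ mD) (i1 D)).
  by move=> x; rewrite sqn_realM -[leRHS]mul1r ler_wpM2r ?sqn_ge0.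
apply: (@le_trans _ _ (N / 2 * (sqint m (fun x => (\1_E' (t x))%:C%C * f x) +
    sqint m (fun x => (\1_E (t x))%:C%C * g x)))); last first.
  by rewrite ler_wpM2l ?divr_ge0 ?(ltW N0)// lerD// sq_le.
have nz (D : set R) x (z : R[i]) : (\1_D (t x))%:C%C * z != 0 -> D (t x).
  rewrite indicE; have [/set_mem//|_] := boolP (t x \in D).
  by rewrite mul0r eqxx.
apply: le_trans (separated_bound el0 N0 tEf tEg _ opN); last first.
  by move=> x y /nz h2 /nz h1; exact: dsep.
rewrite le_eqVlt; apply/orP; left; apply/eqP/eq_Rintegral => p _.
by rewrite kE hformM; ring.
Qed.

End separated.

(** * Oscillation bounds on a cube *)

Section oscillation.
Context (R : realType) (d : nat).
Local Notation m := (lebs R d).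
Local Notation coord := (@Defs.coord R d).
Variables (c : nat -> R) (l : R) (b1 b2 : Rd R d -> R[i]).
Hypotheses (d0 : (0 < d)%N) (l0 : 0 < l).
Local Notation Q := (cube (d := d) c l).

Let mQ : measurable Q. Proof. exact: measurable_cube. Qed.
Let Qoo : (m Q < +oo)%E. Proof. by rewrite leb_cube// ltry. Qed.

(** The 4 comes from the coins, the power from |x - y|^(d-1), the factor 2 d from summing d
    coordinate differences, and 1/2 from [BD_separated_kernel]. *)
Definition dimconst : R := 4 * ((2 * d.+1%:R) ^+ d.-1 * (d%:R * 2 / 2)).

Lemma BD_one_cube N : sq_on m Q b1 -> sq_on m Q b2 ->
  sq_on m Q (fun x => b1 x * b2 x) -> 0 < N ->
  (forall j : 'I_d, (opnorm2 (CbT b1 b2 (riesz (d := d) j)) <= N%:E)%E) ->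
  BD m Q b1 b2 (fun=> 1) (dimconst * N * l ^+ d).
Proof.
move=> hb1 hb2 hb12 N0 opN.
have mco k : measurable_fun setT (fun x => coord x k) by exact: measurable_coord.
have Qco x k : Q x -> (k < d)%N -> c k <= coord x k < c k + l.
  by move=> qx kd; exact: qx.
have := @BD_one _ _ _ m Q b1 b2 mQ Qoo hb1 hb2 hb12 (nco coord c l 0)
  ((2 * l * d.+1%:R) ^+ d.-1 * (d%:R * (2 * l * (N / 2)))).
rewrite (_ : 4 * _ = dimconst * N * l ^+ d); last first.
  have -> : l ^+ d = l * l ^+ d.-1 by rewrite -exprS prednK.
  rewrite /dimconst (_ : 2 * l * d.+1%:R = 2 * d.+1%:R * l); last by ring.
  by rewrite exprMn; field.
apply.
- exact: (measurable_nco c l mco).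
- by move=> x qx; exact: (nco_itv l0 Qco qx d0).
- rewrite (_ : mkset _ = [set p | coord p.1 0%N = coord p.2 0%N]); first exact: diag_coord0.
  apply/funext => p /=; apply/propext; split; last by rewrite /nco => ->.
  move=> h; apply: (addIr (- c 0%N)); apply: (mulIf (x := l^-1)) => //.
  by rewrite invr_eq0 gt_eqF.
- move=> E E' e e0 mE mE' sep.
  apply: (BD_riesz mQ Qoo hb1 hb2 hb12 mco l0 Qco d0).
  + apply: measurable_funM.
      exact: (measurable_fun_p1 (measurable_indic_t (measurable_nco c l mco 0) mE)).
    exact: (measurable_fun_p2 (measurable_indic_t (measurable_nco c l mco 0) mE')).
  (* At distance 0 the first coordinates agree, so the points cannot lie in separated sets. *)
  + move=> p dp0; rewrite !indicE.
    have [h1|_] := boolP (nco coord c l 0 p.1 \in E); last by rewrite mul0r.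
    have [h2|_] := boolP (nco coord c l 0 p.2 \in E'); last by rewrite mulr0.
    have e1 : coord p.1 0%N = coord p.2 0%N.
      apply/eqP; rewrite -subr_eq0 -normr_le0 -dp0.
      exact: (coord_le_dist (j := 0%N)).
    have := sep _ _ (set_mem h1) (set_mem h2).
    by rewrite /nco e1 subrr normr0 leNgt e0.
  + move=> j; exact: (BD_separated_kernel l0 (ltn_ord j) hb1 hb2 hb12 d0 e0 N0 mE mE' sep (opN j)).
Qed.

(** The kernel k involves only differences of values of each symbol. *)
Lemma BD_shift (u v : R[i]) rho A : BD m Q b1 b2 rho A ->
  BD m Q (fun x => b1 x - u) (fun x => b2 x - v) rho A.
Proof.
move=> [A0 brho h]; split => // f g tf tg; apply: le_trans (h f g tf tg).
rewrite le_eqVlt; apply/orP; left; apply/eqP/eq_Rintegral => p _.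
congr (_ * _); rewrite /hform; congr (complex.Re (_ * _)); ring.
Qed.

Lemma sq_onB u v : sq_on m Q u -> sq_on m Q v -> sq_on m Q (fun x => u x - v x).
Proof.
move=> [mu iu] [mv iv]; split; first exact: cmeasB.
apply: (@rintegrable_le _ _ _ _ _ (fun x => 2 * (\1_Q x * sqn (u x) + \1_Q x * sqn (v x)))).
- apply: measurable_funM; first exact: measurable_indic.
  exact/measurable_sqn/cmeasB.
- move=> x; rewrite ger0_norm; last by rewrite mulr_ge0 ?sqn_ge0// indicE.
  rewrite -mulrDr mulrCA ler_wpM2l//.
  rewrite -subr_ge0 (_ : _ - _ = sqn (u x + v x)) ?sqn_ge0//.
  by rewrite /sqn !ReImE; ring.
- exact/rintegrableZ/rintegrableD.
Qed.

Lemma sq_onZ z u : sq_on m Q u -> sq_on m Q (fun x => z * u x).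
Proof.
move=> [mu iu]; split; first by apply: cmeasM => //; exact: cmeas_cst.
by under eq_fun do rewrite sqnM mulrCA; exact: rintegrableZ.
Qed.

Lemma sq_on_cst z : sq_on m Q (fun=> z).
Proof. by have := sq_onZ z (sq_on1 mQ Qoo); under eq_fun do rewrite mulr1. Qed.

Lemma Lploc_sq_on2 u : Lploc 2 u -> sq_on m Q u.
Proof.
move=> [mu iu]; split => //; apply: rintegrable_ge0.
- apply: measurable_funM; first exact: measurable_indic.
  exact: measurable_sqn.
- by move=> x; rewrite mulr_ge0 ?sqn_ge0// indicE.
- have Qc : cubes Q by exists c, l.
  apply: le_lt_trans (iu Q Qc); rewrite [leRHS]integral_mkcond.
  rewrite le_eqVlt; apply/orP; left; apply/eqP/eq_integral => x _.
  rewrite patchE indicE; case: ifP => _; last by rewrite mul0r.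
  by rewrite mul1r cabs_sqr.
Qed.

(** On Q, |u|^2 <= 1 + |u|^3, and Q has finite measure. *)
Lemma Lploc_sq_on3 u : Lploc 3 u -> sq_on m Q u.
Proof.
move=> [mu iu]; split => //.
have i3 : rintegrable m (fun x => \1_Q x * cabs (u x) ^+ 3).
  apply: rintegrable_ge0.
  - apply: measurable_funM; first exact: measurable_indic.
    exact/measurable_funX/measurable_cabs.
  - by move=> x; rewrite mulr_ge0 ?exprn_ge0 ?cabs_ge0// indicE.
  - have Qc : cubes Q by exists c, l.
    apply: le_lt_trans (iu Q Qc); rewrite [leRHS]integral_mkcond.
    rewrite le_eqVlt; apply/orP; left; apply/eqP/eq_integral => x _.
    rewrite patchE indicE; case: ifP => _; last by rewrite mul0r.
    by rewrite mul1r.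
apply: (@rintegrable_le _ _ _ _ _ (fun x => \1_Q x + \1_Q x * cabs (u x) ^+ 3)).
- apply: measurable_funM; first exact: measurable_indic.
  exact: measurable_sqn.
- move=> x; rewrite ger0_norm; last by rewrite mulr_ge0 ?sqn_ge0// indicE.
  rewrite -[X in _ <= X + _]mulr1 -mulrDr ler_wpM2l//.
  rewrite -cabs_sqr; have := cabs_ge0 (u x); set a := cabs _ => a0.
  have [a1|a1] := leP a 1.
    apply: (@le_trans _ _ 1); first exact: exprn_ile1.
    by rewrite lerDl exprn_ge0.
  by rewrite exprS (_ : a ^+ 3 = a * a ^+ 2) 1?exprS//; nra.
- exact/rintegrableD/i3/(rintegrable_indic mQ Qoo).
Qed.

Lemma cavg_mean_zero u : sq_on m Q u ->
  Cint m (fun x => (u x - cavg Q u) * wconj Q (fun=> 1) x) = 0.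
Proof.
move=> hu; have h1 := sq_on1 mQ Qoo.
have i1 := cintegrable_wconj mQ hu h1; have i2 := cintegrable_wconj1 mQ Qoo h1.
under eq_fun do rewrite mulrBl.
rewrite CintB//; last exact: cintegrableZ.
rewrite CintZ//.
have -> : Cint m (fun x => u x * wconj Q (fun=> 1) x) = cint Q u.
  apply: complex_eq; rewrite /= [RHS]Rintegral_mkcond; apply: eq_Rintegral => x _;
    rewrite patchE /wconj conjc1 mulr1 ?ReM ?ImM indicE; case: (_ \in _) => /=;
    by rewrite ?mulr1 ?mulr0 ?subr0 ?addr0 ?add0r.
have -> : Cint m (wconj Q (fun=> 1)) = ((fine (m Q))%:C)%C.
  rewrite (_ : wconj Q (fun=> 1) = fun x => ((\1_Q x)%:C)%C); last first.
    by apply/funext => x; rewrite /wconj conjc1 mulr1.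
  apply: complex_eq => /=.
    rewrite -[RHS]mul1r -Rintegral_cst// [RHS]Rintegral_mkcond.
    by apply: eq_Rintegral => x _; rewrite patchE indicE; case: (_ \in _).
  rewrite -[RHS](mul0r (fine (m setT))) -Rintegral_cst//.
rewrite /cavg mulrAC -rmorphM/= mulVf ?mul1r ?subrr//.
by rewrite [fine _](_ : _ = l ^+ d) ?expf_neq0 ?gt_eqF// [X in fine X]leb_cube.
Qed.

Lemma ravgE (h : Rd R d -> R) : rintegrable m (fun x => \1_Q x * h x) ->
  ravg Q h = ((l ^+ d)^-1 * \int[m]_x (\1_Q x * h x))%:E.
Proof.
move=> ih; rewrite /ravg EFinM EFin_Rintegral// integral_mkcond.
rewrite [in LHS](_ : fine _ = l ^+ d); last by rewrite [X in fine X]leb_cube.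
congr (_ * _)%E; apply: eq_integral => x _.
by rewrite patchE indicE; case: ifP => _; rewrite ?mul1r ?mul0r.
Qed.

Hypotheses (hb1 : Lploc 3 b1) (hb2 : Lploc 3 b2) (hb12 : Lploc 2 (fun x => b1 x * b2 x)).
Variable N : R.
Hypotheses (N0 : 0 < N)
  (opN : forall j : 'I_d, (opnorm2 (CbT b1 b2 (riesz (d := d) j)) <= N%:E)%E).

Let be1 x := b1 x - cavg Q b1.
Let be2 x := b2 x - cavg Q b2.
Let sb1 := Lploc_sq_on3 hb1.
Let sb2 := Lploc_sq_on3 hb2.
Let sb12 := Lploc_sq_on2 hb12.

Let sbe1 : sq_on m Q be1. Proof. exact: sq_onB sb1 (sq_on_cst _). Qed.
Let sbe2 : sq_on m Q be2. Proof. exact: sq_onB sb2 (sq_on_cst _). Qed.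

(** Expanding the product leaves multiples of b1 b2, b1, b2 and 1, each square integrable on Q. *)
Let sbe12 : sq_on m Q (fun x => be1 x * be2 x).
Proof.
rewrite (_ : (fun _ => _) = (fun x => (b1 x * b2 x - cavg Q b2 * b1 x)
  - (cavg Q b1 * b2 x - cavg Q b1 * cavg Q b2))).
  apply: sq_onB; apply: sq_onB => //; try exact: sq_onZ.
  exact: sq_on_cst.
by apply/funext => x; rewrite /be1 /be2; ring.
Qed.

Let A := dimconst * N * l ^+ d.

Let hBD : BD m Q be1 be2 (fun=> 1) A.
Proof. exact/BD_shift/BD_one_cube. Qed.

Let ld0 : 0 < l ^+ d. Proof. exact: exprn_gt0. Qed.

Lemma dimconst_ge0 : 0 <= dimconst.
Proof. by rewrite !mulr_ge0// exprn_ge0// mulr_ge0. Qed.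

(** The mean-zero bound is 4 A^2 with A = D N |Q| and D = [dimconst]. Dividing by |Q|^2 leaves (2 D
    N)^2, free of the size of the cube. *)
Lemma Tp_cube :
  ((ravg Q (fun x => (osc Q b1 x `^ 2 * osc Q b2 x `^ 2)%R)) `^ (2^-1)%R <=
   (2 * dimconst * N)%:E)%E.
Proof.
have e x : osc Q b1 x `^ 2 * osc Q b2 x `^ 2 = sqn (be1 x * be2 x).
  by rewrite !powR_mulrn ?cabs_ge0// /osc !cabs_sqr sqnM.
under [X in ravg Q X]eq_fun do rewrite e.
rewrite ravgE; last by case: sbe12.
have := mean_zero_product_bound mQ Qoo sbe1 sbe2 sbe12
  (cavg_mean_zero sb1) (cavg_mean_zero sb2) hBD.
have -> : fine (m Q) = l ^+ d by rewrite leb_cube.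
rewrite -/(sqQ m Q (fun x => be1 x * be2 x)).
set X := sqQ _ _ _ => hX; have X0 : 0 <= X by exact: sqQ_ge0.
have v0 : 0 <= (l ^+ d)^-1 * X by rewrite mulr_ge0// invr_ge0 ltW.
rewrite poweR_EFin powR12_sqrt// lee_fin.
rewrite -(@ler_pXn2r _ 2)// ?nnegrE ?sqrtr_ge0 ?mulr_ge0 ?dimconst_ge0 ?(ltW N0)//.
rewrite sqr_sqrtr// mulrC ler_pdivrMr//.
rewrite -(ler_pM2l ld0) (le_trans hX)// le_eqVlt; apply/orP; left; apply/eqP.
by rewrite /A; ring.
Qed.

(** The product of the two means carries |Q|^(-2), which again cancels the |Q|^2 in 4 A^2. *)
Lemma Sp_cube :
  ((ravg Q (fun x => (osc Q b1 x `^ 2)%R)) `^ (2^-1)%R *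
   (ravg Q (fun x => (osc Q b2 x `^ 2)%R)) `^ (2^-1)%R <=
   (2 * dimconst * N)%:E)%E.
Proof.
have e b x : osc Q b x `^ 2 = sqn (b x - cavg Q b).
  by rewrite powR_mulrn ?cabs_ge0// /osc cabs_sqr.
under [X in (ravg Q X `^ _ * _)%E]eq_fun do rewrite e.
under [X in (_ * ravg Q X `^ _)%E]eq_fun do rewrite e.
rewrite ravgE; last by case: sbe1.
rewrite ravgE; last by case: sbe2.
have := mean_zero_square_bound mQ Qoo sbe1 sbe2 sbe12
  (cavg_mean_zero sb1) (cavg_mean_zero sb2) hBD.
rewrite -/(sqQ m Q be1) -/(sqQ m Q be2).
set Y1 := sqQ _ _ be1; set Y2 := sqQ _ _ be2 => hY.
have Y10 : 0 <= Y1 by exact: sqQ_ge0.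
have Y20 : 0 <= Y2 by exact: sqQ_ge0.
have li0 : 0 <= (l ^+ d)^-1 by rewrite invr_ge0 ltW.
have v1 : 0 <= (l ^+ d)^-1 * Y1 by rewrite mulr_ge0.
have v2 : 0 <= (l ^+ d)^-1 * Y2 by rewrite mulr_ge0.
rewrite !poweR_EFin !powR12_sqrt// -EFinM lee_fin -sqrtrM//.
rewrite -(@ler_pXn2r _ 2)// ?nnegrE ?sqrtr_ge0 ?mulr_ge0 ?dimconst_ge0 ?(ltW N0)//.
rewrite sqr_sqrtr ?mulr_ge0//.
rewrite (_ : _ * _ = Y1 * Y2 / (l ^+ d) ^+ 2); last by field; rewrite gt_eqF.
rewrite ler_pdivrMr ?exprn_gt0// (le_trans hY)// le_eqVlt; apply/orP; left; apply/eqP.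
by rewrite /A; ring.
Qed.

End oscillation.

Theorem theorem2p4 (R : realType) (d : nat) :
  (1 <= d)%N ->
  exists C : R, 0 < C /\
    forall b1 b2 : Rd R d -> R[i],
      Lploc 3 b1 -> Lploc 3 b2 -> Lploc 2 (fun x => b1 x * b2 x) ->
      (Sp 2 b1 b2 + Tp 2 b1 b2
         <= C%:E * \sum_(j < d) opnorm2 (CbT b1 b2 (riesz (d := d) j)))%E.
Proof.
(* Each of the two suprema contributes 2 D; the extra 1 makes the constant visibly positive. *)
move=> d0; pose D : R := dimconst R d; exists (4 * D + 1).
have D0 : 0 <= D by exact: dimconst_ge0.
have C0 : 0 < 4 * D + 1 by rewrite ltr_wpDl// mulr_ge0.
split=> // b1 b2 h1 h2 h12.
pose op (j : 'I_d) := opnorm2 (CbT b1 b2 (riesz (d := d) j)).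
have op0 j : (0 <= op j)%E.
  apply: (@le_trans _ _ (L2norm (CbT b1 b2 (riesz (d := d) j) (fun=> 0)))).
    exact: Lnorm_ge0.
  apply: ereal_sup_ubound; exists (fun=> 0) => //; split.
    split; first by split; exact: measurable_cst.
    split; first by exists 0 => x; rewrite /cabs/= !expr0n/= addr0 sqrtr0.
    by exists (cube (fun=> 0) 1); split=> //; exists (fun=> 0), 1.
  rewrite /L2norm (_ : (fun x => _) = cst 0%E); first by rewrite Lnorm0.
  by apply/funext => x; rewrite /cabs/= !expr0n/= addr0 sqrtr0.
have S0 : (0 <= \sum_(j < d) op j)%E by apply: sume_ge0.
rewrite -/(op _).
(* An infinite sum makes the right-hand side infinite, as the constant is positive. *)
have [->|Soo] := eqVneq (\sum_(j < d) op j)%E +oo%E.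
  by rewrite gt0_muley ?leey// lte_fin.
have Sfin : (\sum_(j < d) op j)%E \is a fin_num by rewrite ge0_fin_numE// lt_neqAle Soo leey.
pose s : R := fine (\sum_(j < d) op j)%E.
have sE : (\sum_(j < d) op j)%E = s%:E by rewrite fineK.
have s0 : 0 <= s by rewrite fine_ge0.
(* The cube bounds ask for N > 0, while s may be 0; so N is taken above s and the excess tends to
   0. *)
suff H N : s < N -> 0 < N -> (Sp 2 b1 b2 + Tp 2 b1 b2 <= ((4 * D + 1) * N)%:E)%E.
  rewrite sE -EFinM; apply/lee_addgt0Pr => r r0.
  have := H (s + r / (4 * D + 1)); rewrite ltrDl divr_gt0// ltr_wpDl ?divr_gt0//.
  move=> /(_ isT isT)/le_trans; apply; rewrite -EFinD lee_fin mulrDr.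
  by rewrite (mulrCA _ r) divff ?mulr1// gt_eqF.
move=> sN N0.
have opN j : (op j <= N%:E)%E.
  apply: le_trans (_ : s%:E <= _)%E; last by rewrite lee_fin ltW.
  by rewrite -sE (bigD1 j)//= leeDl// sume_ge0.
have hS : (Sp 2 b1 b2 <= (2 * D * N)%:E)%E.
  apply: ge_ereal_sup => _ [_ [c [l [l0 ->]]] <-].
  exact: Sp_cube.
have hT : (Tp 2 b1 b2 <= (2 * D * N)%:E)%E.
  apply: ge_ereal_sup => _ [_ [c [l [l0 ->]]] <-].
  exact: Tp_cube.
apply: (le_trans (leeD hS hT)); rewrite -EFinD lee_fin.
rewrite [leRHS](_ : _ = 2 * D * N + 2 * D * N + N); last by ring.
by rewrite lerDl ltW.
Qed.
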